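(* Let $U\subset\mathbb R^N$ be open, fix a structure (for each of $M$ equations, the set of variables allowed to appear in it), let $\mathcal F$ be any vector space of $C^\infty$ functions $F:U\to\mathbb R^M$ respecting the structure and containing all linear functions that respect the structure, and let $r$ be the maximum possible rank of the Jacobian, which depends only on the structure. If $r=M$, then $\text{SolSet}(p)$ is robust for almost every $F\in\mathcal F$ and almost every $p\in U$.
   Context: Structure. A structure specifies, for each $i\in\{1,\dots,M\}$, a subset of $\{x_1,\dots,x_N\}$ of variables allowed to appear in the $i$-th equation (possibly all variables). A $C^1$ function $F=(f_1,\dots,f_M):U\to\mathbb R^M$ respects the structure if $\partial f_i/\partial x_j\equiv 0$ on $U$ whenever $x_j$ is not allowed in equation $i$. A linear function $x\mapsto Ax$ respects the structure if $A_{ij}=0$ whenever $x_j$ is not allowed in equation $i$. The number $r$ is the maximum rank of all $M\times N$ real matrices $A$ with $A_{ij}=0$ whenever $x_j$ is not allowed in equation $i$; equivalently, the maximum possible rank of $DF(x)$ for $F\in\mathcal F$, $x\in U$. Robustness. A point $x\in U$ is robust for $F$ if $DF(x)$ has rank $M$, and fragile if it is not robust. For $p\in U$, $\text{SolSet}(p)=\{x\in U: F(x)=F(p)\}$; it is robust if every $x\in\text{SolSet}(p)$ is robust for $F$. Almost every. ''Almost every $p\in U$'' is with respect to Lebesgue measure. ''Almost every $F\in\mathcal F$'' is in the sense of prevalence: a property holds for almost every $F\in\mathcal F$ if there is a finite-dimensional subspace $P\subset\mathcal F$ such that for every $F\in\mathcal F$ the function $F+q$ has the property for Lebesgue-almost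 every $q\in P$. The conclusion means: for almost every $F\in\mathcal F$, the assertion holds for almost every $p\in U$. *)

(* Defs.v *)
From HB Require Import structures.
From mathcomp Require Import all_boot all_order all_algebra.
From mathcomp Require Import all_classical all_reals all_analysis.
Set Implicit Arguments.
Unset Strict Implicit.
Unset Printing Implicit Defensive.
Import Order.TTheory GRing.Theory Num.Theory.
Import numFieldNormedType.Exports.
Local Open Scope classical_set_scope.
Local Open Scope ring_scope.

(* MathComp / MathComp-Analysis.  Points of R^n are row vectors, and a         *)
(* function U -> R^M is a total function of which only the values on U matter. *)

Section Lebesgue_null.
Context {R : realType} {n : nat}.
Implicit Types (a b : 'rV[R]_n) (A : set 'rV[R]_n).

Definition box a b : set 'rV[R]_n :=
  [set x | forall j, a 0 j <= x 0 j <= b 0 j].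

Definition box_volume a b : R := \prod_(j < n) (b 0 j - a 0 j).

(* The filter D permits finite and empty covers; this matters only for n = 0,  *)
(* where every box is the whole space and has volume 1.                        *)
Definition lebesgue_outer A : \bar R :=
  ereal_inf [set v | exists (D : pred nat) (a b : nat -> 'rV[R]_n),
    [/\ forall k j, a k 0 j <= b k 0 j,
        A `<=` \bigcup_(k in [set k | D k]) box (a k) (b k)
      & v = (\sum_(0 <= k <oo | D k) (box_volume (a k) (b k))%:E)%E ]].

Definition lebesgue_null A : Prop := lebesgue_outer A = 0%E.

(* Property Q holds at Lebesgue-almost every point of U. *)
Definition almost_every (U : set 'rV[R]_n) (Q : 'rV[R]_n -> Prop) : Prop :=
  lebesgue_null [set x | U x /\ ~ Q x].

End Lebesgue_null.

Section Smooth.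
Context {R : realType} {N M : nat}.
Implicit Types (F : 'rV[R]_N -> 'rV[R]_M) (U : set 'rV[R]_N).

Definition partial (j : 'I_N) F : 'rV[R]_N -> 'rV[R]_M :=
  'D_(delta_mx 0 j) F.

Definition iter_partial (s : seq 'I_N) F : 'rV[R]_N -> 'rV[R]_M :=
  foldr partial F s.

(* C^oo on the open set U: iterated partial derivatives of all orders exist    *)
(* and are continuous on U.                                                    *)
Definition smooth_on U F : Prop :=
  forall (s : seq 'I_N) x, U x ->
    {for x, continuous (iter_partial s F)} /\
    forall j, derivable (iter_partial s F) x (delta_mx 0 j).

(* The library's Jacobian acts on row vectors on the right, whence the         *)
(* transpose: the (i, j) entry of DF(x) is the derivative of f_i along x_j.    *)
Definition DF F x : 'M[R]_(M, N) := ('J F x)^T.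

Definition robust_point F x : Prop := \rank (DF F x) = M.

Definition SolSet U F p : set 'rV[R]_N := [set x | U x /\ F x = F p].

Definition robust_SolSet U F p : Prop :=
  forall x, SolSet U F p x -> robust_point F x.

(* q is linearly independent as a family of functions on U. *)
Definition independent_on U k (q : 'I_k -> 'rV[R]_N -> 'rV[R]_M) : Prop :=
  forall c : 'rV[R]_k,
    (forall x, U x -> \sum_(i < k) c 0 i *: q i x = 0) -> c = 0.

(* Prevalence.  The finite-dimensional subspace P of Fs is given by a basis q, *)
(* and the Lebesgue-null subsets of P, which do not depend on the choice of    *)
(* basis, are those with a Lebesgue-null set of coordinate vectors.            *)
Definition prevalent U (Fs : set ('rV[R]_N -> 'rV[R]_M))
    (Q : ('rV[R]_N -> 'rV[R]_M) -> Prop) : Prop :=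
  exists (k : nat) (q : 'I_k -> 'rV[R]_N -> 'rV[R]_M),
    [/\ forall i, Fs (q i),
        independent_on U q
      & forall F, Fs F ->
          almost_every [set: 'rV[R]_k]
            (fun c => Q (F + \sum_(i < k) c 0 i *: q i)) ].

End Smooth.

(* j \in S i means that the variable x_j is allowed in equation i. *)
Definition structure (N M : nat) := 'I_M -> {set 'I_N}.

Section Structure.
Context {R : realType} {N M : nat}.
Variable S : structure N M.

Definition respects (U : set 'rV[R]_N) (F : 'rV[R]_N -> 'rV[R]_M) : Prop :=
  forall i j, j \notin S i ->
    forall x, U x -> 'D_(delta_mx 0 j) (fun y => F y 0 i) x = 0.

Definition mx_respects (A : 'M[R]_(M, N)) : Prop :=
  forall i j, j \notin S i -> A i j = 0.

(* A vector space of C^oo functions on U respecting S and containing all       *)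
(* linear functions x |-> A x that respect S.  As only values on U matter,     *)
(* containing a function means containing one that coincides with it on U.     *)
Definition function_space (U : set 'rV[R]_N)
    (Fs : set ('rV[R]_N -> 'rV[R]_M)) : Prop :=
  [/\ submod_closed (mem Fs),
      forall F, Fs F -> smooth_on U F /\ respects U F
    & forall A, mx_respects A ->
        exists2 F, Fs F & forall x, U x -> F x = x *m A^T ].

End Structure.

Definition max_rank (R : realType) (N M : nat) (S : structure N M) : nat :=
  \max_(k < M.+1 |
    `[< exists2 A : 'M[R]_(M, N), mx_respects S A & \rank A = k >]) k.

(* The bound k <= M in max_rank loses nothing. *)
Lemma max_rankP (R : realType) (N M : nat) (S : structure N M) :
  (exists2 A : 'M[R]_(M, N), mx_respects S A & \rank A = max_rank R S) /\
  (forall A : 'M[R]_(M, N), mx_respects S A -> (\rank A <= max_rank R S)%N).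
Proof.
split; last first.
  move=> A SA; have rA : (\rank A < M.+1)%N by rewrite ltnS rank_leq_row.
  by apply: (leq_bigmax_cond (Ordinal rA)); apply/asboolP; exists A.
rewrite /max_rank; apply: (big_ind (fun k : nat =>
  exists2 A : 'M[R]_(M, N), mx_respects S A & \rank A = k)).
- by exists 0; [move=> i j _; rewrite mxE | rewrite mxrank0].
- by move=> k l hk hl; rewrite /maxn; case: ifP.
- by move=> k /asboolP.
Qed.

(* Main.v *)
Require Import Defs.
From mathcomp Require Import all_boot all_order all_algebra.
From mathcomp Require Import fingroup perm.
From mathcomp Require Import all_classical all_reals all_analysis.
From mathcomp Require Import ring lra zify.
Set Implicit Arguments.
Unset Strict Implicit.
Unset Printing Implicit Defensive.
Import Order.TTheory GRing.Theory Num.Theory.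
Import numFieldNormedType.Exports.
Local Open Scope classical_set_scope.
Local Open Scope ring_scope.

(** Perturbing [F] by a structured linear map whose free entries are [c] gives
    [F_c x = F x + x *m B_c].  A point [p] has a non robust solution set only if
    [p] is a critical point of [F_c] or [F_c p] is a critical value of [F_c].
    Three facts therefore suffice: for almost every [c] the critical values
    form a null set ([null_critical_values]), for almost every [c] the critical
    points form a null set ([null_critical_points]), and at regular points the
    preimage of a null set is null ([null_regular_preimage]).

    The first two facts do not go through the theorem of Sard: the freedom in
    [c] replaces it by a count of dimensions that only uses second derivatives.
    Let [x] be critical, let [l] be a nonzero covector annihilated by the
    Jacobian of [F_c] at [x], let [I] be the support of [l] and [J] the set of
    variables allowed in some equation of [I].  The equations of [I] involve
    only the coordinates [x_j], [j] in [J].  For each [j] in [J], column [j] of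
    the criticality condition can be solved for one entry of [B_c], so that this
    entry depends in a Lipschitz way on [x_J], on [l] and on the other entries.
    - For critical values, record the pair [(c, F_c x)] by replacing the [#|J|]
      solved entries by [x_J] and the [#|I|] coordinates of the value in [I] by
      the entries of [l].  One entry of [l] is normalized to 1, so one coordinate
      carries no information.
    - For critical points, record the pair [(c, x)] by keeping [x] and replacing
      the [#|J|] solved entries by the remaining [#|I| - 1] entries of [l].
      Maximal rank [M] provides a matching of the equations to distinct allowed
      variables, whence [#|I| <= #|J|], and again a coordinate is left over.
    In both cases a subset of R^a x R^b is described, in a way with Lipschitz
    inverse, by [a + b - 1] bounded parameters.  At scale [tau] it is thus covered
    by about [tau ^- (a + b - 1)] cubes, and a counting argument
    ([slices_at_scale]) shows that almost all its slices over R^a are null in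
    R^b ([null_slices]); this stands in for Fubini's theorem.  Countably many
    choices of a small cube, of [I], of the normalized index and of the bounds
    exhaust all critical points ([ae_critical_null]). *)

(** * Null sets through countable covers by cubes *)


Section Covers.
Context {R : realType} {d : nat}.
Implicit Types (z : 'rV[R]_d) (r : R) (E : set 'rV[R]_d) (v : \bar R).

Definition cube z r : set 'rV[R]_d := [set x | forall j, `|x 0 j - z 0 j| <= r].

(** Cubes, unlike boxes, behave well under Lipschitz maps; arguments use this
    notion and pass to boxes only in [null_lebesgue_null].  The index set [D]
    allows finite and empty covers. *)
Definition covered E v := exists (D : set nat) (z : nat -> 'rV[R]_d) (r : nat -> R),
  [/\ forall k, 0 < r k,
      E `<=` \bigcup_(k in D) cube (z k) (r k)
    & (\esum_(k in D) (r k ^+ d)%:E <= v)%E].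

Definition null E := forall eta : R, 0 < eta -> covered E eta%:E.

Lemma covered_le E E' v v' : E `<=` E' -> (v' <= v)%E -> covered E' v' -> covered E v.
Proof.
move=> EE' vv' [D [z [r [r0 cE sE]]]]; exists D, z, r; split => //.
  exact: subset_trans cE.
exact: le_trans vv'.
Qed.

(** Any countable index type will do: indices are transported to [nat] by
    [pickle]. *)
Lemma covered_count (T : countType) (D : set T) (z : T -> 'rV[R]_d) (r : T -> R) E v :
  (forall t, 0 < r t) -> E `<=` \bigcup_(t in D) cube (z t) (r t) ->
  (\esum_(t in D) (r t ^+ d)%:E <= v)%E -> covered E v.
Proof.
move=> r0 cE sE.
pose z' n := if unpickle n is Some t then z t else 0.
pose r' n := if unpickle n is Some t then r t else 1.
exists (pickle @` D), z', r'; split.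
- by move=> k; rewrite /r'; case: unpickle => [t|//]; exact: r0.
- move=> x /cE [t Dt xt]; exists (pickle t); first by exists t.
  by rewrite /z' /r' pickleK.
- rewrite esum_image; last by move=> ? ? _ _; exact: (pcan_inj pickleK).
  by under eq_esum => i _ do rewrite /r' pickleK.
Qed.

Lemma covered_finset (T : finType) (A : {set T}) (z : T -> 'rV[R]_d) r E (v : R) :
  0 < r -> (forall x, E x -> exists2 t, t \in A & cube (z t) r x) ->
  #|A|%:R * r ^+ d <= v -> covered E v%:E.
Proof.
move=> r0 cE sE; apply: (@covered_count T [set` A] z (fun=> r)) => //.
rewrite esum_fset//; last by move=> *; rewrite lee_fin exprn_ge0// ltW.
rewrite (_ : [set` A] = [set` enum A]); last first.
  by apply/seteqP; split=> t /=; rewrite mem_enum.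
rewrite -fsbig_seq ?enum_uniq//.
rewrite sumEFin lee_fin big_enum_cond/= (eq_bigl (mem A)); last first.
  by move=> t; rewrite andbT.
by rewrite sumr_const -mulr_natl.
Qed.

Lemma covered_bigcup (D : set nat) (E : nat -> set 'rV[R]_d) (v : nat -> \bar R) :
  (forall k, D k -> covered (E k) (v k)) ->
  covered (\bigcup_(k in D) E k) (\esum_(k in D) v k)%E.
Proof.
move=> cE.
have /choice [p pP] (k : nat) : exists p : set nat * (nat -> 'rV[R]_d) * (nat -> R),
    D k -> [/\ forall i, 0 < p.2 i,
      E k `<=` \bigcup_(i in p.1.1) cube (p.1.2 i) (p.2 i)
    & (\esum_(i in p.1.1) (p.2 i ^+ d)%:E <= v k)%E].
  case: (pselect (D k)) => [Dk|nDk]; last by exists (set0, (fun=> 0), (fun=> 1)).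
  by have [A [z [r h]]] := cE _ Dk; exists (A, z, r).
(* Outside [D] the choice gives no cover, so the radius needs a positive default. *)
pose r t := if `[< D t.1 >] then (p t.1).2 t.2 else 1.
apply: (@covered_count (nat * nat)%type
  (D `*`` (fun k => (p k).1.1)) (fun t => (p t.1).1.2 t.2) r).
- by move=> [i j]; rewrite /r; case: asboolP => //= Di; have [] := pP _ Di.
- move=> x [k Dk Ex]; have [_ /(_ _ Ex) [i pi xi] _] := pP _ Dk.
  by exists (k, i) => //; rewrite /r /=; case: asboolP.
- rewrite -(@esum_esum _ _ _ _ _ (fun i j => (r (i, j) ^+ d)%:E)); last first.
    move=> i j Di _; rewrite lee_fin exprn_ge0// /r /=; case: asboolP => // _.
    by have [h _ _] := pP _ Di; exact: ltW.
  apply: le_esum => i Di; have [_ _] := pP _ Di; apply: le_trans.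
  by apply: le_esum => j _; rewrite /r/=; case: asboolP.
Qed.

Lemma null_sub E E' : E `<=` E' -> null E' -> null E.
Proof. by move=> EE' nE eta eta0; exact: covered_le EE' (lexx _) (nE _ eta0). Qed.

Lemma null_set0 : null set0.
Proof.
move=> eta eta0; exists set0, (fun=> 0), (fun=> 1); split => //.
by rewrite esum_set0 lee_fin ltW.
Qed.

Lemma null_bigcup (T : countType) (E : T -> set 'rV[R]_d) :
  (forall t, null (E t)) -> null (\bigcup_t E t).
Proof.
move=> nE eta eta0.
pose E' n := if unpickle n is Some t then E t else set0.
pose v n := (eta / (2 ^ n.+1)%:R)%:E.
apply: (@covered_le _ (\bigcup_n E' n) _ (\esum_(n in setT) v n)%E).
- by move=> x [t _ Et]; exists (pickle t) => //; rewrite /E' pickleK.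
- rewrite -nneseries_esumT; last by move=> n; rewrite lee_fin divr_ge0// ltW.
  exact/epsilon_trick0/ltW.
- apply: covered_bigcup => n _; rewrite /v.
  have v0 : 0 < eta / (2 ^ n.+1)%:R by rewrite divr_gt0// ltr0n expn_gt0.
  by rewrite /E'; case: unpickle => [t|]; [exact: nE | exact: null_set0].
Qed.

Lemma null_union E E' : null E -> null E' -> null (E `|` E').
Proof.
move=> nE nE'; apply: (@null_sub _ (\bigcup_b (if b then E else E'))).
  by move=> x [Ex|Ex]; [exists true | exists false].
by apply: null_bigcup => -[].
Qed.

Lemma null_lebesgue_null E : null E -> lebesgue_null E.
Proof.
move=> nE; apply/eqP; rewrite eq_le; apply/andP; split; last first.
  apply: le_ereal_inf_tmp => _ [D [a [b [ab _ ->]]]]; apply: nneseries_ge0 => k _ _.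
  by rewrite lee_fin prodr_ge0// => j _; rewrite subr_ge0.
apply/lee_addgt0Pr => e e0; rewrite add0e.
have [D [z [r [r0 cE sE]]]] := nE (e / 2 ^+ d) (divr_gt0 e0 (exprn_gt0 _ (ltr0Sn _ 1))).
pose a k := z k - const_mx (r k); pose b k := z k + const_mx (r k).
have volE k : box_volume (a k) (b k) = (2 * r k) ^+ d.
  rewrite /box_volume -[X in _ ^+ X]card_ord -prodr_const.
  by apply: eq_bigr => j _; rewrite !mxE; ring.
apply: ge_ereal_inf; exists (\sum_(0 <= k <oo | k \in D) (box_volume (a k) (b k))%:E)%E.
  exists (fun k => k \in D), a, b; split => //.
    by move=> k j; rewrite !mxE lerD2l ge0_cp// ltW.
  move=> x /cE [k Dk xk]; exists k; first by rewrite /= inE.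
  by move=> j; have := xk j; rewrite !mxE ler_distl.
under eq_eseriesr do rewrite volE exprMn EFinM.
rewrite nneseriesZl; last by move=> k _; rewrite lee_fin exprn_ge0// ltW.
rewrite nneseries_esum; last by move=> k _; rewrite lee_fin exprn_ge0// ltW.
rewrite set_mem_set muleC -lee_pdivlMr ?exprn_gt0//.
Qed.

End Covers.

(** * Slices of sets parametrized by one coordinate too few *)


Lemma grid (R : realType) (B tau : R) : 0 <= B -> 0 < tau ->
  exists m (cell : R -> 'I_m), m%:R <= 2 * B / tau + 1 /\
    forall s s', `|s| <= B -> `|s'| <= B -> cell s = cell s' -> `|s - s'| <= tau.
Proof.
move=> B0 tau0; pose idx s := Num.trunc ((s + B) / tau).
have bnd s : `|s| <= B -> (idx s)%:R <= (s + B) / tau < (idx s).+1%:R.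
  rewrite ler_norml => /andP[sB _]; apply: Num.Theory.truncn_itv.
  by rewrite divr_ge0 ?(ltW tau0)//; lra.
have BB : (Num.trunc (2 * B / tau))%:R <= 2 * B / tau < (Num.trunc (2 * B / tau)).+1%:R.
  by apply: Num.Theory.truncn_itv; rewrite divr_ge0 ?mulr_ge0// ltW.
exists (Num.trunc (2 * B / tau)).+1, (fun s => inord (idx s)); split.
  by rewrite -natr1 lerD2r; case/andP: BB.
have idx_lt s : `|s| <= B -> (idx s < (Num.trunc (2 * B / tau)).+1)%N.
  move=> sB; have /andP[h _] := bnd _ sB; case/andP: BB => _ h2.
  rewrite -(ltr_nat R); apply: le_lt_trans h (le_lt_trans _ h2).
  by rewrite ler_pM2r ?invr_gt0//; have := ler_norm s; lra.
move=> s s' sB s'B /(congr1 val); rewrite /= !inordK ?idx_lt// => e.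
have := bnd _ s'B; rewrite -e; have := bnd _ sB; rewrite -!natr1.
rewrite !ler_pdivlMr// !ltr_pdivrMr// mulrDl mul1r => /andP[h1 h2] /andP[h3 h4].
by rewrite ler_norml; apply/andP; split; lra.
Qed.

(** A maximal family of pairwise disjoint sets [G c] is small because the sets
    are large, and by maximality every [G c] meets one of its members.  It
    replaces the Markov inequality in [slices_at_scale]. *)
Lemma maximal_disjoint_subfamily (C : Type) (Gamma : finType) (bad : set C)
    (G : C -> {set Gamma}) (K m : nat) :
  (forall c, bad c -> (K < #|G c| * m)%N) ->
  exists DD : {set {set Gamma}},
    [/\ forall D, D \in DD -> exists2 c, bad c & G c = D,
        (#|DD| * K <= #|Gamma| * m)%N
      & forall c, bad c -> exists2 D, D \in DD & D :&: G c != finset.set0].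
Proof.
move=> GK.
pose P (DD : {set {set Gamma}}) := finset.trivIset DD &&
  [forall (D | D \in DD), `[< exists2 c, bad c & G c = D >]].
have P0 : P finset.set0.
  apply/andP; split; last by apply/forall_inP => D; rewrite finset.inE.
  by apply/finset.trivIsetP => D D'; rewrite finset.inE.
have [DD /maxsetP[/andP[tDD /forall_inP DDb] maxDD] _] := maxset_exists P0.
have DDbad D : D \in DD -> exists2 c, bad c & G c = D by move=> /DDb /asboolP.
exists DD; split => //.
- apply: (@leq_trans (#|finset.cover DD| * m)); last by rewrite leq_mul2r max_card orbT.
  rewrite -(eqP tDD) big_distrl /= -sum_nat_const; apply: leq_sum => D /DDbad [c bc <-].
  exact/ltnW/GK.
- move=> c bc; have G0 : G c != finset.set0.
    by rewrite -card_gt0; have := GK _ bc; case: #|_|.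
  apply: contrapT => nex.
  have disj D : D \in DD -> D :&: G c == finset.set0.
    by move=> DDD; apply/negPn/negP => h; apply: nex; exists D.
  have PP : P (G c |: DD).
    apply/andP; split.
      apply/finset.trivIsetP => D D'; rewrite !finset.inE => /orP[/eqP->|DDD] /orP[/eqP->|DDD'].
      - by rewrite eqxx.
      - by rewrite -finset.setI_eq0 finset.setIC => _; exact: disj.
      - by rewrite -finset.setI_eq0 => _; exact: disj.
      - by move/finset.trivIsetP: tDD; apply.
    apply/forall_inP => D; rewrite !finset.inE => /orP[/eqP->|/DDb//].
    by apply/asboolP; exists c.
  have GDD : G c \in DD by rewrite -(maxDD _ PP (finset.subsetUr _ _)) finset.setU11.
  by apply: nex; exists (G c) => //; rewrite finset.setIid.
Qed.

(** Cells of side [tau = m ^- 2] in the [a + b - 1] parameters other than [o]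
    each describe points within [L * tau] of one another.  Call [c0] bad when more
    than [m ^ (2 b - 1)] of the cells lie near it.  Slices over good [c0] are covered
    by few small cubes.  Bad points are covered too: sets of cells near the points of
    a maximal disjoint subfamily share the [m ^ (2 (a + b - 1))] cells available, so
    about [m ^ (2 a - 1)] cubes of side [tau] suffice.  The exponents are balanced so
    that both volumes are of order [1 / m]. *)
Lemma slices_at_scale (R : realType) (a b : nat) (W : Type) (P : set W)
    (c : W -> 'rV[R]_a) (y : W -> 'rV[R]_b) (t : W -> 'I_a + 'I_b -> R)
    (o : 'I_a + 'I_b) (B L : R) (m : nat) :
  0 <= B -> 0 < L -> (0 < m)%N ->
  (forall w s, P w -> `|t w s| <= B) ->
  (forall w w' (tau : R), P w -> P w' -> 0 <= tau ->
    (forall s, s != o -> `|t w s - t w' s| <= tau) ->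
    (forall j, `|c w 0 j - c w' 0 j| <= L * tau) /\
    (forall j, `|y w 0 j - y w' 0 j| <= L * tau)) ->
  exists bad : set 'rV[R]_a,
    covered bad ((2 * B + 1) ^+ (a + b).-1 * (2 * L) ^+ a / m%:R)%:E /\
    forall c0, ~ bad c0 ->
      covered [set y w | w in [set w | P w /\ c w = c0]] (L ^+ b / m%:R)%:E.
Proof.
move=> B0 L0 m0 tB tL; have mR : 0 < m%:R :> R by rewrite ltr0n.
pose tau : R := (m%:R ^+ 2)^-1.
have tau0 : 0 < tau by rewrite invr_gt0 exprn_gt0.
have [mu [cell [mule cellP]]] := grid B0 tau0.
pose T : finType := {s | s != o}.
pose Gamma : finType := {ffun T -> 'I_mu}.
pose gam w : Gamma := [ffun s => cell (t w (val s))].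
have close w w' : P w -> P w' -> gam w = gam w' ->
    (forall j, `|c w 0 j - c w' 0 j| <= L * tau) /\
    (forall j, `|y w 0 j - y w' 0 j| <= L * tau).
  move=> Pw Pw' e; apply: tL => //; first exact: ltW.
  move=> s so; apply: cellP; rewrite ?tB//.
  by have /ffunP /(_ (Sub s so)) := e; rewrite !ffunE.
pose occ g := exists2 w, P w & gam w = g.
have /choice [p pP] (g : Gamma) : exists p : 'rV[R]_a * 'rV[R]_b,
    occ g -> exists w, [/\ P w, gam w = g & p = (c w, y w)].
  case: (pselect (occ g)) => [[w Pw gw]|no]; last by exists (0, 0).
  by exists (c w, y w) => _; exists w.
pose G c0 : {set Gamma} := [set g | `[< occ g /\ cube (p g).1 (L * tau) c0 >]]%SET.
pose bad := [set c0 | (m ^ (2 * b) < #|G c0| * m)%N].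
have Lt0 : 0 < L * tau by rewrite mulr_gt0.
exists bad; split; last first.
  move=> c0 /negP; rewrite -leqNgt => Gle.
  apply: (@covered_finset _ _ _ (G c0) (fun g => (p g).2) (L * tau)) => //.
    move=> _ [w [Pw <-] <-]; have [|w' [Pw' ew' pw']] := pP (gam w); first by exists w.
    have [cc yy] := close _ _ Pw Pw' (esym ew').
    exists (gam w); last by rewrite pw'.
    by rewrite finset.inE; apply/asboolP; split; [exists w | rewrite pw'].
  rewrite exprMn mulrCA ler_pM2l ?exprn_gt0// /tau exprVn -exprM ler_pdivrMr ?exprn_gt0//.
  by rewrite mulrC ler_pdivlMr// -natrX -natrM ler_nat.
(* Points whose sets of cells meet are within [2 * L * tau] of each other. *)
have [DD [DDbad DDcard DDmeet]] := maximal_disjoint_subfamily (G := G) (bad := bad) (fun c h => h).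
have /choice [z zP] (D : {set Gamma}) : exists z : 'rV[R]_a, D \in DD -> G z = D.
  case: (boolP (D \in DD)) => [/DDbad [z _ <-]|_]; by [exists z | exists 0].
have r0 : 0 < 2 * (L * tau) by rewrite mulr_gt0.
apply: (@covered_finset _ _ _ DD z (2 * (L * tau))) => //.
  move=> c0 /DDmeet [D DDD /finset.set0Pn [g]]; rewrite finset.in_setI => /andP[].
  rewrite -{1}(zP _ DDD) !finset.inE => /asboolP[_ h1] /asboolP[_ h2].
  exists D => // j; have := h1 j; have := h2 j; rewrite !ler_norml => /andP[? ?] /andP[? ?].
  by apply/andP; split; lra.
have ab0 : (0 < a + b)%N by case: (o) => -[i hi]; lia.
have cardT : #|T| = (a + b).-1.
  by rewrite card_sig -[LHS]/#|predC1 o| cardC1 card_sum !card_ord.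
have mu1 : mu%:R <= (2 * B + 1) * m%:R ^+ 2 :> R.
  have m21 : 1 <= m%:R ^+ 2 :> R by rewrite -natrX ler1n expn_gt0 m0.
  by apply: le_trans mule _; rewrite /tau invrK; lra.
have GammaE : (#|Gamma|%:R : R) <= (2 * B + 1) ^+ (a + b).-1 * (m%:R ^+ 2) ^+ (a + b).-1.
  rewrite card_ffun card_ord cardT natrX -exprMn lerXn2r ?nnegrE//.
  by rewrite mulr_ge0 ?exprn_ge0//; lra.
rewrite mulrA !exprMn /tau exprVn ler_pdivlMr//.
have mb0 : 0 < m%:R ^+ (2 * b) :> R by rewrite exprn_gt0.
have ma0 : 0 < (m%:R ^+ 2) ^+ a :> R by rewrite !exprn_gt0.
have key : #|DD|%:R * m%:R <= (2 * B + 1) ^+ (a + b).-1 * (m%:R ^+ 2) ^+ a.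
  rewrite -(ler_pM2r mb0).
  have DDR : #|DD|%:R * m%:R ^+ (2 * b) <= #|Gamma|%:R * m%:R :> R.
    by rewrite -natrX -!natrM ler_nat.
  have := ler_wpM2r (ltW mR) DDR; have := ler_wpM2r (ltW mR) (ler_wpM2r (ltW mR) GammaE).
  set X := (2 * B + 1) ^+ _.
  have -> : X * (m%:R ^+ 2) ^+ (a + b).-1 * m%:R * m%:R =
            X * (m%:R ^+ 2) ^+ a * m%:R ^+ (2 * b).
    have e : (m%:R ^+ 2) ^+ a * m%:R ^+ (2 * b) = (m%:R ^+ 2) ^+ (a + b).-1 * m%:R ^+ 2 :> R.
      by rewrite exprM -exprD -exprSr prednK.
    by rewrite -[RHS]mulrA e expr2 !mulrA.
  by move=> h1 h2; rewrite mulrAC; exact: le_trans h2 h1.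
have L2 : 0 < 2 ^+ a * L ^+ a by rewrite mulr_gt0 ?exprn_gt0.
rewrite (_ : _ * _ * _ = #|DD|%:R * m%:R * (2 ^+ a * L ^+ a) / (m%:R ^+ 2) ^+ a); last by ring.
by rewrite ler_pdivrMr// [leRHS]mulrAC ler_pM2r.
Qed.

Lemma ler_divn (R : realType) (K eta : R) : 0 < eta ->
  exists J, forall m, (J <= m)%N -> (0 < m)%N /\ K / m%:R <= eta.
Proof.
move=> eta0; have [n nK] : exists n, K / eta <= n%:R.
  by exists (Num.trunc (K / eta)).+1; apply/ltW/truncnS_gt.
exists n.+1 => m nm; have m0 : (0 < m)%N by apply: leq_trans nm.
split => //; rewrite ler_pdivrMr ?ltr0n// mulrC -ler_pdivrMr//.
by apply: le_trans nK _; rewrite ler_nat ltnW.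
Qed.

(** A point over which the slice is not null is bad at every large scale, and
    the bad sets have volume tending to zero.  The hypothesis says that [t], without
    its coordinate [o], is an injective description of [(c, y)] with Lipschitz
    inverse. *)
Lemma null_slices (R : realType) (a b : nat) (W : Type) (P : set W)
    (c : W -> 'rV[R]_a) (y : W -> 'rV[R]_b) (t : W -> 'I_a + 'I_b -> R)
    (o : 'I_a + 'I_b) (B L : R) :
  0 <= B -> 0 < L ->
  (forall w s, P w -> `|t w s| <= B) ->
  (forall w w' (tau : R), P w -> P w' -> 0 <= tau ->
    (forall s, s != o -> `|t w s - t w' s| <= tau) ->
    (forall j, `|c w 0 j - c w' 0 j| <= L * tau) /\
    (forall j, `|y w 0 j - y w' 0 j| <= L * tau)) ->
  null [set c0 | ~ null [set y w | w in [set w | P w /\ c w = c0]]].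
Proof.
move=> B0 L0 tB tL.
pose K := (2 * B + 1) ^+ (a + b).-1 * (2 * L) ^+ a.
have /choice [bad badP] (m : nat) : exists bad : set 'rV[R]_a, (0 < m)%N ->
    covered bad (K / m%:R)%:E /\
    forall c0, ~ bad c0 ->
      covered [set y w | w in [set w | P w /\ c w = c0]] (L ^+ b / m%:R)%:E.
  have [m0|m0] := ltnP 0 m; last by exists set0.
  by have [A ?] := slices_at_scale B0 L0 m0 tB tL; exists A.
apply: (@null_sub _ _ _ (\bigcup_J [set c0 | forall m, (J <= m)%N -> bad m c0])).
  move=> c0 /= nn; apply: contrapT => nbad; apply: nn => eta eta0.
  have [J JP] := ler_divn (L ^+ b) eta0.
  have [m Jm nb] : exists2 m, (J <= m)%N & ~ bad m c0.
    apply: contrapT => h; apply: nbad; exists J => // m Jm.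
    by apply: contrapT => nb; apply: h; exists m.
  have [m0 mle] := JP _ Jm.
  by apply: covered_le ((badP _ m0).2 _ nb).
apply: null_bigcup => J eta eta0; have [J' JP] := ler_divn K eta0.
have [m0 mle] := JP _ (leq_maxr J J').
by apply: covered_le (badP _ m0).1; [move=> c0 /=; apply; exact: leq_maxl|rewrite lee_fin].
Qed.

(** * Preimages of null sets and local arguments *)


Lemma esumZl (R : realType) (D : set nat) (K : R) (f : nat -> \bar R) :
  (forall k, 0 <= f k)%E -> 0 <= K ->
  (\esum_(k in D) (K%:E * f k) = K%:E * \esum_(k in D) f k)%E.
Proof.
move=> f0 K0; rewrite -(set_mem_set D) -!nneseries_esum ?nneseriesZl//.
by move=> k _; rewrite mule_ge0.
Qed.

(** On this set [g] varies by at most [2 * r].  Cutting the coordinates [pr] into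
    intervals of length [r] leaves pieces of diameter of order [r], about
    [r ^- #|T|] of them, and [r ^+ N * r ^- #|T| = r ^+ M]. *)
Lemma covered_preimage_cube (R : realType) (N M : nat) (T : finType) (pr : T -> 'I_N)
    (E : set 'rV[R]_N) (g : 'rV[R]_N -> 'rV[R]_M) (B L : R) (z : 'rV[R]_M) (r : R) :
  (#|T| + M)%N = N -> 0 <= B -> 0 < L -> 0 < r -> r <= 1 ->
  (forall p s, E p -> `|p 0 (pr s)| <= B) ->
  (forall p p' (tau : R), E p -> E p' -> 0 <= tau ->
    (forall i, `|g p 0 i - g p' 0 i| <= tau) ->
    (forall s, `|p 0 (pr s) - p' 0 (pr s)| <= tau) ->
    forall j, `|p 0 j - p' 0 j| <= L * tau) ->
  covered (E `&` g @^-1` cube z r) (((2 * B + 1) ^+ #|T| * (2 * L) ^+ N) * r ^+ M)%:E.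
Proof.
move=> TMN B0 L0 r0 r1 EB EL.
have [m [cell [mle cellP]]] := grid B0 r0.
pose gam (p : 'rV[R]_N) : {ffun T -> 'I_m} := [ffun s => cell (p 0 (pr s))].
pose A := E `&` g @^-1` cube z r.
have /choice [c cP] (gm : {ffun T -> 'I_m}) : exists p : 'rV[R]_N,
    (exists2 p, A p & gam p = gm) -> A p /\ gam p = gm.
  by case: (pselect (exists2 p, A p & gam p = gm)) => [[p Ap gp]|?]; [exists p|exists 0].
have r2 : 0 < L * (2 * r) by rewrite !mulr_gt0.
apply: (@covered_finset _ _ _ [set: {ffun T -> 'I_m}]%SET c (L * (2 * r))) => //.
  move=> p Ap; exists (gam p); first by rewrite finset.inE.
  have [[Ec gc] ec] := cP (gam p) (ex_intro2 _ _ p Ap erefl).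
  have [Ep gp] := Ap; apply: EL => //; first by rewrite mulr_ge0// ltW.
    move=> i; have := gp i; have := gc i; rewrite !ler_norml => /andP[? ?] /andP[? ?].
    by apply/andP; split; lra.
  move=> s; apply: (@le_trans _ _ r); last by lra.
  apply: cellP; rewrite ?EB//.
  by have /ffunP /(_ s) := ec; rewrite !ffunE.
rewrite cardsT card_ffun card_ord natrX.
have mr : m%:R * r <= 2 * B + 1.
  have := ler_wpM2r (ltW r0) mle; rewrite mulrDl divfK ?gt_eqF//; lra.
have : (m%:R * r) ^+ #|T| <= (2 * B + 1) ^+ #|T|.
  by rewrite lerXn2r// nnegrE ?mulr_ge0//; lra.
have X0 : 0 <= (2 * L) ^+ N * r ^+ M by rewrite mulr_ge0 ?exprn_ge0 ?mulr_ge0//; lra.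
move=> /(ler_wpM2r X0); rewrite !mulrA; apply: le_trans.
by rewrite -TMN !exprMn !exprD le_eqVlt; apply/orP; left; apply/eqP; ring.
Qed.

Lemma null_preimage (R : realType) (N M : nat) (T : finType) (pr : T -> 'I_N)
    (E : set 'rV[R]_N) (g : 'rV[R]_N -> 'rV[R]_M) (C : set 'rV[R]_M) (B L : R) :
  (#|T| + M)%N = N -> (0 < M)%N -> 0 <= B -> 0 < L -> null C ->
  (forall p, E p -> C (g p)) ->
  (forall p s, E p -> `|p 0 (pr s)| <= B) ->
  (forall p p' (tau : R), E p -> E p' -> 0 <= tau ->
    (forall i, `|g p 0 i - g p' 0 i| <= tau) ->
    (forall s, `|p 0 (pr s) - p' 0 (pr s)| <= tau) ->
    forall j, `|p 0 j - p' 0 j| <= L * tau) ->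
  null E.
Proof.
move=> TMN M0 B0 L0 nC EC EB EL eta eta0.
set K := (2 * B + 1) ^+ #|T| * (2 * L) ^+ N.
have K0 : 0 < K by rewrite mulr_gt0 ?exprn_gt0 ?mulr_gt0//; lra.
have [|D [z [r [r0 cC sC]]]] := nC (Num.min 1 (eta / K)).
  by rewrite lt_min ltr01 divr_gt0.
have r1 k : D k -> r k <= 1.
  move=> Dk; rewrite -(@expr_le1 _ M)// ?(ltW (r0 _))// -lee_fin.
  apply: (@le_trans _ _ (Num.min 1 (eta / K))%:E); last by rewrite lee_fin ge_min lexx.
  apply: le_trans sC; apply: esum_ge; exists [set k]; last by rewrite fsbig_set1.
  by split; [exact: finite_set1 | move=> _ ->].
apply: (@covered_le _ _ _ (\bigcup_(k in D) (E `&` g @^-1` cube (z k) (r k))) _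
  (\esum_(k in D) (K * r k ^+ M)%:E)%E).
- by move=> p Ep; have [k Dk gk] := cC _ (EC _ Ep); exists k.
- under eq_esum do rewrite EFinM.
  rewrite esumZl; [|by move=> k; rewrite lee_fin exprn_ge0// ltW|exact: ltW].
  rewrite muleC -lee_pdivlMr//; apply: le_trans sC _.
  by rewrite lee_fin ge_min lexx orbT.
- apply: covered_bigcup => k Dk.
  exact: (covered_preimage_cube (z k) TMN B0 L0 (r0 k) (r1 _ Dk) EB EL).
Qed.

(** The Lindelof property, in the form used for hereditary local properties: the
    cubes with rational centre and radius that have property [Q] suffice. *)
Lemma rational_cubes (R : realType) (N : nat) (U : set 'rV[R]_N) (Q : set 'rV[R]_N -> Prop) :
  Q set0 -> (forall A B, A `<=` B -> Q B -> Q A) ->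
  (forall x, U x -> exists2 r : R, 0 < r & Q (cube x r)) ->
  exists E : 'rV[rat]_N * rat -> set 'rV[R]_N,
    (forall t, Q (E t)) /\ U `<=` \bigcup_t E t.
Proof.
move=> Q0 QS QU.
pose B (t : 'rV[rat]_N * rat) : set 'rV[R]_N := cube (map_mx ratr t.1) (ratr t.2).
exists (fun t => if `[< Q (B t) >] then B t else set0); split.
  by move=> t; case: asboolP.
move=> x Ux; have [r r0 Qr] := QU _ Ux.
have [rho] := rat_in_itvoo (divr_gt0 r0 (ltr0n R 2)).
rewrite in_itv /= => /andP[rho0 rhor].
have /choice [q qP] (j : 'I_N) : exists q : rat, x 0 j < ratr q < x 0 j + ratr rho.
  have xx : x 0 j < x 0 j + ratr rho by rewrite ltrDl.
  by have [q] := rat_in_itvoo xx; rewrite in_itv /= => h; exists q.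
exists (\row_j q j, rho) => //=.
have xB : B (\row_j q j, rho) x.
  move=> j; rewrite !mxE /= ler_norml; have /andP[h1 h2] := qP j.
  by apply/andP; split; lra.
case: asboolP => //= nQ; exfalso; apply: nQ; apply: QS Qr => y yB j.
have := yB j; have := xB j; rewrite /= !mxE !ler_norml => /andP[? ?] /andP[? ?].
by apply/andP; split; lra.
Qed.

Lemma locally_null (R : realType) (N : nat) (V : set 'rV[R]_N) :
  (forall x, V x -> exists2 r : R, 0 < r & null (V `&` cube x r)) -> null V.
Proof.
move=> loc.
have [||E [nE VE]] := rational_cubes (Q := fun A => null (V `&` A)) _ _ loc.
- by rewrite setI0; exact: null_set0.
- by move=> A B AB; apply: null_sub; exact: setIS.
- apply: null_sub (null_bigcup nE) => x Vx.
  by have [t _ Et] := VE _ Vx; exists t.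
Qed.

(** * The mean value inequality along coordinate directions *)


Lemma is_derive_line (R : realType) (N : nat) (f : 'rV[R]_N -> R) (x v : 'rV[R]_N) (s : R) :
  derivable f (x + s *: v) v ->
  is_derive s 1 (fun s => f (x + s *: v)) ('D_v f (x + s *: v)).
Proof.
have E : (fun h : R => h^-1 *: (f (x + (h *: 1 + s) *: v) - f (x + s *: v)))
       = (fun h : R => h^-1 *: (f (h *: v + (x + s *: v)) - f (x + s *: v))).
  by apply/funext => h; rewrite /= [h *: 1]mulr1 scalerDl addrCA.
move=> df; apply: DeriveDef.
  by rewrite /derivable /= E; exact: df.
by rewrite /derive /= E.
Qed.

Lemma mvt_line (R : realType) (N : nat) (f : 'rV[R]_N -> R) (x v : 'rV[R]_N) (l : R) :
  (forall s : R, Num.min 0 l <= s <= Num.max 0 l -> derivable f (x + s *: v) v) ->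
  exists2 s : R, Num.min 0 l <= s <= Num.max 0 l &
    f (x + l *: v) - f x = l * 'D_v f (x + s *: v).
Proof.
move=> df; pose phi s := f (x + s *: v).
have dphi s : s \in `[Num.min 0 l, Num.max 0 l] ->
    is_derive s 1 phi ('D_v f (x + s *: v)).
  by rewrite in_itv /= => /df; exact: is_derive_line.
have mM : Num.min 0 l <= Num.max 0 l by rewrite ge_min !le_max lexx.
have cphi : {within `[Num.min 0 l, Num.max 0 l], continuous phi}.
  by apply: derivable_within_continuous => s /dphi [].
have dphi' s : s \in `]Num.min 0 l, Num.max 0 l[ ->
    is_derive s 1 phi ('D_v f (x + s *: v)).
  by move=> /subset_itv_oo_cc; exact: dphi.
have [s] := MVT_segment mM dphi' cphi.
rewrite in_itv /= => sI; rewrite /phi => e; exists s => //; move: e.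
case: (leP 0 l) => l0; rewrite scale0r addr0 ?subr0 ?sub0r => e; first by rewrite mulrC.
by apply: oppr_inj; rewrite opprB e mulrN mulrC.
Qed.

(** The segment from [x] to [x'] is replaced by a path that changes one
    coordinate at a time, so that only partial derivatives enter; each step is the
    mean value theorem in one variable. *)
Lemma mvt_coords (R : realType) (N : nat) (f : 'rV[R]_N -> R) (z x x' : 'rV[R]_N) (r : R) :
  (forall y j, cube z r y -> derivable f y (delta_mx 0 j)) ->
  cube z r x -> cube z r x' ->
  exists2 xi : 'I_N -> 'rV[R]_N, (forall j, cube z r (xi j)) &
    f x' - f x = \sum_j (x' 0 j - x 0 j) * 'D_(delta_mx 0 j) f (xi j).
Proof.
move=> df zx zx'.
pose mix k : 'rV[R]_N := \row_j (if (j < k)%N then x' 0 j else x 0 j).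
have mixS (j : 'I_N) : mix j.+1 = mix j + (x' 0 j - x 0 j) *: delta_mx 0 j.
  apply/rowP => i; rewrite !mxE /= ltnS leq_eqVlt.
  have [->|ij] := eqVneq i j; first by rewrite eqxx ltnn /= mulr1 addrC subrK.
  by rewrite val_eqE (negbTE ij) /= mulr0 addr0.
have /choice [xi xiP] (j : 'I_N) : exists xij : 'rV[R]_N, cube z r xij /\
    f (mix j.+1) - f (mix j) = (x' 0 j - x 0 j) * 'D_(delta_mx 0 j) f xij.
  have seg (s : R) : Num.min 0 (x' 0 j - x 0 j) <= s <= Num.max 0 (x' 0 j - x 0 j) ->
      cube z r (mix j + s *: delta_mx 0 j).
    move=> sI i; rewrite !mxE /=.
    have := zx i; have := zx' i; have [->|ij] := eqVneq i j; last first.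
      by rewrite mulr0 addr0; case: ifP.
    rewrite ltnn mulr1; move: sI; rewrite !ler_norml; case: (leP 0 (x' 0 j - x 0 j)) => _;
    by move=> /andP[? ?] /andP[? ?] /andP[? ?]; apply/andP; split; lra.
  have [s sI e] := mvt_line (fun s h => df _ j (seg s h)).
  by exists (mix j + s *: delta_mx 0 j); split; [exact: seg | rewrite mixS e].
exists xi; first by move=> j; have [] := xiP j.
have mix0 : mix 0%N = x by apply/rowP => j; rewrite mxE.
have mixN : mix N = x' by apply/rowP => j; rewrite mxE ltn_ord.
rewrite -{1}mixN -{1}mix0 -(telescope_sumr (fun k => f (mix k)))// big_mkord.
by apply: eq_bigr => j _; have [] := xiP j.
Qed.

(** * Smooth maps and their Jacobian matrices *)


Lemma coord_le_norm (R : realType) (N : nat) (h : 'rV[R]_N) j : `|h 0 j| <= `|h|.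
Proof.
rewrite [leRHS]/Num.Def.normr/= mx_normrE.
exact: (le_bigmax _ (fun ij : 'I_1 * 'I_N => `|h ij.1 ij.2|) (ord0, j)).
Qed.

Lemma norm_le_coord (R : realType) (N : nat) (h : 'rV[R]_N) (e : R) :
  0 <= e -> (forall j, `|h 0 j| <= e) -> `|h| <= e.
Proof.
move=> e0 he; rewrite [leLHS]/Num.Def.normr/= mx_normrE; apply: bigmax_le => // -[i j] _.
by rewrite /= ord1.
Qed.

Lemma nbhs_cube (R : realType) (N : nat) (x : 'rV[R]_N) (P : set 'rV[R]_N) :
  nbhs x P -> exists2 r : R, 0 < r & cube x r `<=` P.
Proof.
move=> /nbhs_ballP [e e0 eP]; exists (e / 2); first by rewrite divr_gt0.
move=> y xy; apply: eP; rewrite -ball_normE /=.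
apply: (@le_lt_trans _ _ (e / 2)); last by rewrite /= in e0; lra.
apply: norm_le_coord; first by rewrite divr_ge0// ltW.
by move=> j; rewrite !mxE distrC; exact: xy.
Qed.

Section Smooth.
Context {R : realType} {N M : nat}.
Implicit Types (F : 'rV[R]_N -> 'rV[R]_M) (U : set 'rV[R]_N).

Definition Jac F x : 'M[R]_(N, M) := \matrix_(j, i) partial j F x 0 i.

Lemma smooth_coord U F x j i : smooth_on U F -> U x ->
  derivable (fun y => F y 0 i) x (delta_mx 0 j) /\
  'D_(delta_mx 0 j) (fun y => F y 0 i) x = Jac F x j i.
Proof.
move=> sF Ux; have [_ /(_ j) dF] := sF [::] x Ux; split.
  exact: (derivable_mxP _ _ _).1 dF 0 i.
by rewrite !mxE /partial derive_mx// mxE.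
Qed.

Lemma smooth_Jac_continuous U F x j i : smooth_on U F -> U x ->
  {for x, continuous (fun y => Jac F y j i)}.
Proof.
move=> sF Ux; have [cF _] := sF [:: j] x Ux.
rewrite (_ : (fun y => Jac F y j i) = (fun A : 'rV[R]_M => A 0 i) \o partial j F); last first.
  by apply/funext => y /=; rewrite mxE.
exact: continuous_comp cF (@coord_continuous _ _ _ _ _ _).
Qed.

Lemma smooth_Jac_coord U F x j i l : smooth_on U F -> U x ->
  [/\ derivable (fun y => Jac F y j i) x (delta_mx 0 l),
      'D_(delta_mx 0 l) (fun y => Jac F y j i) x = partial l (partial j F) x 0 i
    & {for x, continuous (fun y => partial l (partial j F) y 0 i)}].
Proof.
move=> sF Ux; have [_ /(_ l) dF] := sF [:: j] x Ux.
have [cF _] := sF [:: l; j] x Ux.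
have E : (fun y => Jac F y j i) = (fun y => partial j F y 0 i).
  by apply/funext => y; rewrite mxE.
rewrite E; split.
- exact: (derivable_mxP _ _ _).1 dF 0 i.
- by rewrite {2}/partial derive_mx// mxE.
- exact: (continuous_comp (f := partial l (partial j F)) cF (@coord_continuous _ _ _ _ _ _)).
Qed.

Lemma near_norm (f : 'rV[R]_N -> R) x e : {for x, continuous f} -> 0 < e ->
  nbhs x [set y | `|f y - f x| <= e].
Proof.
move=> /cvgrPdist_le cf e0; have := cf e e0.
by apply: filterS => y /=; rewrite distrC.
Qed.

(** Continuous partial derivatives give the Frechet differential by
    [mvt_coords].  Robustness is defined from that differential, and this ties it to
    partial derivatives. *)
Lemma smooth_differentiable U F x : open U -> smooth_on U F -> U x ->
  differentiable F x /\ jacobian F x = Jac F x.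
Proof.
move=> oU sF Ux.
pose A := Jac F x.
have cA : continuous (mulmxr A : 'rV[R]_N -> 'rV[R]_M).
  have -> : (mulmxr A : 'rV[R]_N -> 'rV[R]_M) = \sum_(j < N) (fun h => h 0 j *: row j A).
    by apply/funext => h; rewrite /= mulmx_sum_row fct_sumE.
  elim/big_ind: _ => [|f g cf cg|j _] h.
  - exact: (@cst_continuous _ _ (0 : 'rV[R]_M)).
  - exact: (continuousD (cf h) (cg h)).
  - apply: (@continuousZl _ _ _ (fun h : 'rV[R]_N => h 0 j) (row j A) h); exact: coord_continuous.
have exp : F \o shift x = cst (F x) + (mulmxr A : {linear 'rV[R]_N -> 'rV[R]_M}) +o_ (0 : 'rV[R]_N) id.
  apply/eqaddoP => e e0.
  have eN : 0 < e / N.+1%:R by rewrite divr_gt0.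
  have [r r0 rP] : exists2 r : R, 0 < r &
      cube x r `<=` [set y | U y /\ forall j i, `|Jac F y j i - A j i| <= e / N.+1%:R].
    have hU : nbhs x U by apply: open_nbhs_nbhs.
    have hJ : \forall y \near x, forall j i, `|Jac F y j i - A j i| <= e / N.+1%:R.
      apply: (@filter_forall _ _ _ (nbhs x) _) => j.
      apply: (@filter_forall _ _ _ (nbhs x) _) => i.
      exact: (near_norm (@smooth_Jac_continuous U F x j i sF Ux) eN).
    exact: nbhs_cube (filterI hU hJ).
  near=> h.
  have hr : `|h| <= r by near: h; rewrite near_simpl; exact: (@nbhs0_le R 'rV[R]_N r r0).
  have cx : cube x r x by move=> j; rewrite subrr normr0 ltW.
  have chx : cube x r (h + x).
    by move=> j; rewrite mxE addrK (le_trans _ hr)// coord_le_norm.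
  have h0 : 0 <= e * `|h| by rewrite mulr_ge0// ltW.
  rewrite /= /cst; apply: norm_le_coord => // i.
  rewrite !fctE /= opprD addrA !mxE.
  have d y j : cube x r y -> derivable (fun y => F y 0 i) y (delta_mx 0 j).
    by move=> /rP [Uy _]; have [] := smooth_coord j i sF Uy.
  have [xi xiC ->] := mvt_coords d cx chx.
  rewrite -sumrB.
  apply: (@le_trans _ _ (\sum_(j < N) `|h| * (e / N.+1%:R))).
    apply: le_trans (ler_norm_sum _ _ _) (ler_sum _ _) => j _.
    have [Uxi Axi] := rP _ (xiC j).
    have [_ ->] := smooth_coord j i sF Uxi.
    rewrite mxE addrK -mulrBr normrM ler_pM//; first exact: coord_le_norm.
  rewrite sumr_const card_ord -[_ *+ _]mulr_natl.
  rewrite [leRHS]mulrC mulrCA ler_wpM2l// mulrA ler_pdivrMr// mulrC.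
  by rewrite ler_wpM2l ?ler_nat// ltW.
have dE : 'd F x = (mulmxr A : 'rV[R]_N -> 'rV[R]_M) :> (_ -> _).
  exact: (diff_unique cA exp).
split.
  by apply/diff_locallyP; rewrite dE; split.
apply/matrixP => j i; rewrite /jacobian /lin1_mx mxE dE /=.
by rewrite -rowE mxE.
Unshelve. all: by end_near. Qed.
End Smooth.

(** * Estimates in the allowed variables only *)


Lemma derive_translate (R : realType) (N : nat) (f : 'rV[R]_N -> R) (y w v : 'rV[R]_N) :
  'D_v (fun z => f (z + w)) y = 'D_v f (y + w).
Proof.
rewrite /derive /=; have -> // : (fun h : R => h^-1 *: (f (h *: v + y + w) - f (y + w)))
  = (fun h : R => h^-1 *: (f (h *: v + (y + w)) - f (y + w))).
by apply/funext => h; rewrite addrA.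
Qed.

Lemma cube_nbhs (R : realType) (N : nat) (x : 'rV[R]_N) (r : R) :
  0 < r -> nbhs x (cube x r).
Proof.
move=> r0; apply/nbhs_ballP; exists r => // y; rewrite -ball_normE /= => xy j.
have := coord_le_norm (x - y) j; rewrite !mxE distrC => /le_trans; apply.
exact: ltW.
Qed.

Section Tame.
Context {R : realType} {N M : nat}.
Variables (S : structure N M) (U : set 'rV[R]_N) (F : 'rV[R]_N -> 'rV[R]_M).

Lemma respects_Jac x j i : smooth_on U F -> respects S U F -> U x ->
  j \notin S i -> Jac F x j i = 0.
Proof.
by move=> sF rF Ux Sij; have [_ <-] := smooth_coord j i sF Ux; exact: rF.
Qed.

(** The map [F] does not depend locally on a disallowed variable [l] in equation
    [i], hence neither do its partial derivatives; this avoids exchanging the order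
    of differentiation. *)
Lemma Jac_disallowed x j l i : open U -> smooth_on U F -> respects S U F -> U x ->
  l \notin S i -> 'D_(delta_mx 0 l) (fun y => Jac F y j i) x = 0.
Proof.
move=> oU sF rF Ux Sil.
have [r r0 rU] : exists2 r : R, 0 < r & cube x r `<=` U.
  by apply: nbhs_cube; exact: open_nbhs_nbhs.
have shift_f z s : cube x r z -> cube x r (z + s *: delta_mx 0 l) ->
    F (z + s *: delta_mx 0 l) 0 i = F z 0 i.
  move=> zr zsr; apply/eqP; rewrite -subr_eq0; apply/eqP.
  have d y k : cube x r y -> derivable (fun y => F y 0 i) y (delta_mx 0 k).
    by move=> /rU Uy; have [] := smooth_coord k i sF Uy.
  have [xi xiC ->] := mvt_coords d zr zsr.
  rewrite big1// => k _; rewrite !mxE /=.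
  have [->|kl] := eqVneq k l; last by rewrite mulr0 addr0 subrr mul0r.
  have [_ ->] := smooth_coord l i sF (rU _ (xiC l)).
  by rewrite respects_Jac ?mulr0//; exact/rU/xiC.
have shift_J s : `|s| <= r / 2 -> Jac F (s *: delta_mx 0 l + x) j i = Jac F x j i.
  move=> sr.
  have sx : cube x r (x + s *: delta_mx 0 l).
    move=> k; rewrite !mxE addrAC subrr add0r /= normrM.
    by case: (k == l); rewrite /= ?normr1 ?normr0 ?mulr1 ?mulr0; lra.
  have [_ <-] := smooth_coord j i sF Ux.
  rewrite addrC; have [_ <-] := smooth_coord j i sF (rU _ sx).
  rewrite -(derive_translate (fun y => F y 0 i)); apply: near_eq_derive.
  have := @cube_nbhs R N x (r / 2) (divr_gt0 r0 (ltr0n R 2)).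
  apply: filterS => y yr; apply: shift_f => k; have := yr k; first lra.
  rewrite !mxE /= => yk; rewrite addrAC (le_trans (ler_normD _ _))//.
  have : `|s * (k == l)%:R| <= r / 2.
    by rewrite normrM; case: (k == l); rewrite /= ?normr1 ?normr0 ?mulr1 ?mulr0; lra.
  lra.
apply/lim_near_cst => //=.
have := @dnbhs0_le R R (r / 2) (divr_gt0 r0 (ltr0n R 2)).
by apply: filterS => s /shift_J ->; rewrite subrr scaler0.
Qed.

(** On a tame piece, [F] and its Jacobian are bounded and Lipschitz, row [i] being
    controlled by the variables of [S i] alone.  This is all that the count of
    dimensions uses of smoothness. *)
Definition tame (K : R) (E : set 'rV[R]_N) := [/\ E `<=` U,
  forall x, E x -> (forall j, `|x 0 j| <= K) /\ (forall j i, `|Jac F x j i| <= K)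
  & forall x x' i tau, E x -> E x' -> 0 <= tau ->
      (forall j, j \in S i -> `|x 0 j - x' 0 j| <= tau) ->
      `|F x 0 i - F x' 0 i| <= K * tau /\
      forall j, `|Jac F x j i - Jac F x' j i| <= K * tau].

Lemma tame_sub K E E' : E `<=` E' -> tame K E' -> tame K E.
Proof.
move=> EE' [EU Eb El]; split.
- exact: subset_trans EU.
- by move=> x /EE'; exact: Eb.
- by move=> x x' i tau /EE' ? /EE' ?; exact: El.
Qed.

Lemma tame_le K K' E : K <= K' -> tame K E -> tame K' E.
Proof.
move=> KK' [EU Eb El]; split => //.
- move=> x /Eb [b1 b2]; split => [j|j i]; exact: le_trans KK'.
- move=> x x' i tau Ex Ex' tau0 h; have [h1 h2] := El x x' i tau Ex Ex' tau0 h.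
  have tt : K * tau <= K' * tau by rewrite ler_wpM2r.
  by split => [|j]; [exact: le_trans tt | exact: le_trans tt].
Qed.

(** Continuity of the second derivatives bounds them near [x]; [mvt_coords] then
    gives the Lipschitz estimates, the terms of disallowed variables being zero. *)
Lemma tame_local x : open U -> smooth_on U F -> respects S U F -> U x ->
  exists2 r : R, 0 < r & exists K, tame K (cube x r).
Proof.
move=> oU sF rF Ux.
pose D2 l j i y := partial l (partial j F) y 0 i.
pose K : R := 1 + \sum_j \sum_i (`|Jac F x j i| + \sum_l `|D2 l j i x|).
have sum_le (I : finType) (f : I -> R) i : (forall i, 0 <= f i) -> f i <= \sum_i f i.
  by move=> f0; rewrite (bigD1 i)//= lerDl sumr_ge0.
have JK j i : `|Jac F x j i| + \sum_l `|D2 l j i x| <= K - 1.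
  rewrite /K addrAC subrr add0r.
  apply: le_trans (sum_le _ (fun j => \sum_i (`|Jac F x j i| + \sum_l `|D2 l j i x|)) j _).
    apply: (sum_le _ (fun i => `|Jac F x j i| + \sum_l `|D2 l j i x|) i) => i'.
    by rewrite addr_ge0// sumr_ge0.
  by move=> j'; rewrite sumr_ge0// => i' _; rewrite addr_ge0// sumr_ge0.
have K1 : 1 <= K.
  rewrite /K lerDl sumr_ge0// => j _; rewrite sumr_ge0// => i _.
  by rewrite addr_ge0// sumr_ge0.
have hU : nbhs x U by apply: open_nbhs_nbhs.
have close_le (a b : R) : `|a - b| <= 1 -> `|b| <= K - 1 -> `|a| <= K.
  by move=> h1 h2; have := ler_normD (a - b) b; rewrite subrK; lra.
have hJ : \forall y \near x, forall j i, `|Jac F y j i| <= K.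
  apply: (@filter_forall _ _ _ (nbhs x) _) => j.
  apply: (@filter_forall _ _ _ (nbhs x) _) => i.
  apply: filterS (near_norm (@smooth_Jac_continuous _ _ _ U F x j i sF Ux) ltr01) => y /=.
  move=> /close_le; apply; apply: le_trans (JK j i).
  by rewrite lerDl sumr_ge0.
have hD : \forall y \near x, forall j i l, `|D2 l j i y| <= K.
  apply: (@filter_forall _ _ _ (nbhs x) _) => j.
  apply: (@filter_forall _ _ _ (nbhs x) _) => i.
  apply: (@filter_forall _ _ _ (nbhs x) _) => l.
  have [_ _ cD] := @smooth_Jac_coord _ _ _ U F x j i l sF Ux.
  apply: filterS (near_norm cD ltr01) => y /= /close_le; apply.
  apply: le_trans (JK j i); apply: ler_wpDl => //.
  by apply: (sum_le _ (fun l => `|D2 l j i x|) l) => ?.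
have hx : nbhs x [set y : 'rV[R]_N | forall j, `|y 0 j| <= K + `|x|].
  have := @cube_nbhs R N x 1 ltr01; apply: filterS => y yx j.
  have := yx j; have := coord_le_norm x j; rewrite /=.
  have := ler_normD (y 0 j - x 0 j) (x 0 j); rewrite subrK; lra.
have [r r0 rP] := nbhs_cube (filterI hU (filterI hJ (filterI hD hx))).
have rU : cube x r `<=` U by move=> y /rP [].
have K0 : 0 <= K by lra.
pose KK := N%:R * K + K + `|x|.
have NK0 : 0 <= N%:R * K by rewrite mulr_ge0.
exists r => //; exists KK; split => //.
  move=> y /rP [_ [h1 [_ h3]]]; have := normr_ge0 x; split => [j|j i].
    by have := h3 j; rewrite /KK; lra.
  by have := h1 j i; rewrite /KK; lra.
have lip (f : 'rV[R]_N -> R) i tau y y' :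
    (forall z j, cube x r z -> derivable f z (delta_mx 0 j)) ->
    (forall z j, cube x r z -> `|'D_(delta_mx 0 j) f z| <= K) ->
    (forall z j, cube x r z -> j \notin S i -> 'D_(delta_mx 0 j) f z = 0) ->
    cube x r y -> cube x r y' -> 0 <= tau ->
    (forall j, j \in S i -> `|y 0 j - y' 0 j| <= tau) ->
    `|f y - f y'| <= KK * tau.
  move=> df bf zf yr y'r tau0 yy'.
  have [xi xiC ->] := mvt_coords df y'r yr.
  apply: (@le_trans _ _ (\sum_(j < N) K * tau)).
    apply: le_trans (ler_norm_sum _ _ _) (ler_sum _ _) => j _.
    have [Sj|nSj] := boolP (j \in S i); last by rewrite zf// mulr0 normr0 mulr_ge0.
    by rewrite normrM mulrC ler_pM//; [exact: bf | exact: yy'].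
  rewrite sumr_const card_ord -mulr_natl mulrA ler_wpM2r// /KK -addrA lerDl.
  by rewrite addr_ge0.
move=> y y' i tau yr y'r tau0 yy'; split.
  apply: (lip (fun y => F y 0 i) i) => //.
  - by move=> z j /rU Uz; have [] := smooth_coord j i sF Uz.
  - move=> z j zr; have [_ ->] := smooth_coord j i sF (rU _ zr).
    by have [_ [h _]] := rP _ zr; exact: h.
  - move=> z j zr Sj; have [_ ->] := smooth_coord j i sF (rU _ zr).
    exact: respects_Jac (rU _ zr) Sj.
move=> j; apply: (lip (fun y => Jac F y j i) i) => //.
- by move=> z l /rU Uz; have [] := smooth_Jac_coord j i l sF Uz.
- move=> z l zr; have [_ -> _] := smooth_Jac_coord j i l sF (rU _ zr).
  by have [_ [_ [h _]]] := rP _ zr; exact: h.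
- by move=> z l zr Sl; exact: Jac_disallowed (rU _ zr) Sl.
Qed.

End Tame.

(** * Critical points of linearly perturbed maps *)


Section Param.
Context {R : realType} {N M k : nat}.
Variables (S : structure N M) (u : 'I_k -> 'I_M * 'I_N).
Hypothesis u_inj : injective u.
Hypothesis u_allowed : forall l, (u l).2 \in S (u l).1.
Hypothesis u_onto : forall i j, j \in S i -> exists l, u l = (i, j).

(** Points are row vectors, so the entry of equation [i] and variable [j] stands in
    row [j] and column [i]. *)
Definition Bmx (c : 'rV[R]_k) : 'M[R]_(N, M) :=
  \sum_l c 0 l *: delta_mx (u l).2 (u l).1.

Lemma Bmx_slot c l : Bmx c (u l).2 (u l).1 = c 0 l.
Proof.
rewrite /Bmx summxE (bigD1 l)//= big1 ?addr0 => [|l' l'l].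
  by rewrite !mxE !eqxx mulr1.
rewrite !mxE; case: eqP => [e2|]; case: eqP => [e1|]; rewrite /= ?mulr0//.
by case/eqP: l'l; apply: u_inj; rewrite [u l']surjective_pairing -e1 -e2 -surjective_pairing.
Qed.

Lemma Bmx_out c i j : j \notin S i -> Bmx c j i = 0.
Proof.
move=> Sij; rewrite /Bmx summxE big1// => l _; rewrite !mxE.
have := u_allowed l; case: eqP => [<-|]; case: eqP => [<-|]; rewrite /= ?mulr0//.
by rewrite (negbTE Sij).
Qed.

Variables (U : set 'rV[R]_N) (F : 'rV[R]_N -> 'rV[R]_M).
Variables (I : {set 'I_M}) (i0 : 'I_M) (delta K : R) (E : set 'rV[R]_N).
Hypothesis i0I : i0 \in I.
Hypothesis delta_gt0 : 0 < delta.
Hypothesis K_ge0 : 0 <= K.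
Hypothesis tameE : tame S U F K E.

(** The equation of [I] whose entry in column [j] is solved for. *)
Definition row_of (j : 'I_N) : 'I_M := odflt i0 [pick i in I | j \in S i].
Definition selected l := ((u l).1 \in I) && ((u l).1 == row_of (u l).2).

Lemma selected_slot i j : i \in I -> j \in S i ->
  exists2 l, selected l & u l = (row_of j, j).
Proof.
move=> iI Sij; have [rI rS] : row_of j \in I /\ j \in S (row_of j).
  by rewrite /row_of; case: pickP => [i' /andP[]//|/(_ i)]; rewrite iI Sij.
by have [l ul] := u_onto rS; exists l; rewrite // /selected ul /= rI eqxx.
Qed.

(** A triple [(c, x, l)] certifying that [x] is critical for [F_c], with [l]
    normalized: its support is [I], entry [i0] is the largest and equals 1, and
    [delta] bounds the others away from 0, so that division by them is Lipschitz. *)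
Definition critical (w : 'rV[R]_k * 'rV[R]_N * 'cV[R]_M) : Prop :=
  [/\ forall l, `|w.1.1 0 l| <= K, E w.1.2,
      (Jac F w.1.2 + Bmx w.1.1) *m w.2 = 0
    & [/\ w.2 i0 0 = 1, forall i, i \in I -> delta <= `|w.2 i 0| <= 1
        & forall i, i \notin I -> w.2 i 0 = 0]].

Definition slot_cst : R := delta^-1 * (M%:R * (3 * K + 1)) + K + 1.

Lemma slot_cst_ge1 : 1 <= slot_cst.
Proof.
have K0 := K_ge0; have K3 : 0 <= 3 * K + 1 by lra.
by rewrite /slot_cst lerDr addr_ge0// mulr_ge0 ?mulr_ge0// invr_ge0; exact: ltW.
Qed.

Lemma Bmx_le w j i : critical w -> `|Bmx w.1.1 j i| <= K.
Proof.
move=> [cK _ _ _]; have [Sij|Sij] := boolP (j \in S i); last by rewrite Bmx_out// normr0.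
by have [l ul] := u_onto Sij; have := cK l; rewrite -Bmx_slot ul.
Qed.

Lemma lambda_le w i : critical w -> `|w.2 i 0| <= 1.
Proof.
move=> [_ _ _ [_ lI lO]]; have [/lI/andP[]//|/lO ->] := boolP (i \in I).
by rewrite normr0.
Qed.

(** Column [j] of the criticality condition reads [\sum_i X i * l i = 0].
    Subtracting it for the two witnesses expresses [l s * (X s - X' s)] by terms that
    the other data control, and [`|l s| >= delta]. *)
Lemma selected_close w w' tau : critical w -> critical w' -> 0 <= tau ->
  (forall i j, i \in I -> j \in S i -> `|w.1.2 0 j - w'.1.2 0 j| <= tau) ->
  (forall i, `|w.2 i 0 - w'.2 i 0| <= tau) ->
  (forall l, ~~ selected l -> `|w.1.1 0 l - w'.1.1 0 l| <= tau) ->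
  forall l, `|w.1.1 0 l - w'.1.1 0 l| <= slot_cst * tau.
Proof.
move=> cw cw' tau0 Hx Hl Hc l; have K0 := K_ge0.
have C1 := slot_cst_ge1.
have [sl|/Hc] := boolP (selected l); last first.
  by move=> /le_trans; apply; rewrite ler_peMl.
have [wK wE wc [_ lI lO]] := cw; have [wK' wE' wc' [_ lI' lO']] := cw'.
have [EU Eb El] := tameE.
pose j := (u l).2; pose s := (u l).1.
have /andP[sI /eqP sj] : (s \in I) && (s == row_of j) by [].
pose X i := (Jac F w.1.2 + Bmx w.1.1) j i; pose X' i := (Jac F w'.1.2 + Bmx w'.1.1) j i.
have XE i : X i = Jac F w.1.2 j i + Bmx w.1.1 j i by rewrite /X [LHS]mxE.
have XE' i : X' i = Jac F w'.1.2 j i + Bmx w'.1.1 j i by rewrite /X' [LHS]mxE.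
have X0 : \sum_i X i * w.2 i 0 = 0.
  by have /matrixP /(_ j 0) := wc; rewrite !mxE => {2}<-; apply: eq_bigr => i _; rewrite /X.
have X0' : \sum_i X' i * w'.2 i 0 = 0.
  by have /matrixP /(_ j 0) := wc'; rewrite !mxE => {2}<-; apply: eq_bigr => i _; rewrite /X'.
have Xle i : `|X' i| <= 2 * K.
  rewrite XE' (le_trans (ler_normD _ _))//.
  have := Bmx_le j i cw'; have [_ /(_ j i)] := Eb _ wE'; lra.
have Jd i : i \in I -> `|Jac F w.1.2 j i - Jac F w'.1.2 j i| <= K * tau.
  by move=> iI; have [_] := El w.1.2 w'.1.2 i tau wE wE' tau0 (fun j => Hx i j iI); apply.
have Bd i : i \in I -> i != s -> `|Bmx w.1.1 j i - Bmx w'.1.1 j i| <= tau.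
  move=> iI is'; have [Sij|Sij] := boolP (j \in S i); last first.
    by rewrite !Bmx_out// subrr normr0.
  have [l' ul'] := u_onto Sij; have := Hc l'; rewrite -!Bmx_slot ul' /=; apply.
  by rewrite /selected ul' /= -sj (negbTE is') andbF.
have Xd i : i \in I -> i != s -> `|X i - X' i| <= (K + 1) * tau.
  move=> iI is'; rewrite XE XE' opprD addrACA (le_trans (ler_normD _ _))// mulrDl mul1r.
  exact: lerD (Jd _ iI) (Bd _ iI is').
have key : w.2 s 0 * (X s - X' s) =
    \sum_i X' i * (w'.2 i 0 - w.2 i 0) - \sum_(i | i != s) (X i - X' i) * w.2 i 0.
  have : \sum_i (X i - X' i) * w.2 i 0 = \sum_i X' i * (w'.2 i 0 - w.2 i 0).
    transitivity (\sum_i X i * w.2 i 0 - \sum_i X' i * w.2 i 0).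
      by rewrite -sumrB; apply: eq_bigr => i _; rewrite mulrBl.
    by rewrite X0; under [RHS]eq_bigr do rewrite mulrBr; rewrite sumrB X0'.
  by rewrite (bigD1 s)//= => <-; rewrite addrK mulrC.
have keyle : `|w.2 s 0 * (X s - X' s)| <= M%:R * (3 * K + 1) * tau.
  rewrite key (le_trans (ler_normB _ _))//.
  have -> : M%:R * (3 * K + 1) * tau = M%:R * (2 * K * tau) + M%:R * ((K + 1) * tau) by ring.
  apply: lerD.
    apply: (@le_trans _ _ (\sum_(i < M) 2 * K * tau)).
      apply: le_trans (ler_norm_sum _ _ _) (ler_sum _ _) => i _.
      by rewrite normrM ler_pM// distrC.
    by rewrite sumr_const card_ord -[leLHS]mulr_natl.
  apply: (@le_trans _ _ (\sum_(i < M) (K + 1) * tau)).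
    rewrite (le_trans (ler_norm_sum _ _ _))//.
    rewrite [leRHS](bigID (fun i => i != s)) /= ler_wpDr//.
      by rewrite sumr_ge0// => i _; rewrite mulr_ge0//; lra.
    apply: ler_sum => i is'; rewrite normrM -[leRHS]mulr1.
    have [iI|/lO ->] := boolP (i \in I).
      by rewrite ler_pM ?Xd// lambda_le.
    by rewrite normr0 mulr0 mulr1 mulr_ge0//; lra.
  by rewrite sumr_const card_ord -[leLHS]mulr_natl.
have Xs : `|X s - X' s| <= delta^-1 * (M%:R * (3 * K + 1)) * tau.
  have /andP[dl _] := lI _ sI; rewrite -mulrA ler_pdivlMl//.
  by apply: le_trans keyle; rewrite normrM ler_wpM2r.
have Js := Jd _ sI.
rewrite -!Bmx_slot -/j -/s.
have -> : Bmx w.1.1 j s - Bmx w'.1.1 j s = (X s - X' s) - (Jac F w.1.2 j s - Jac F w'.1.2 j s).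
  by rewrite XE XE' opprD addrACA [RHS]addrC addKr.
apply: le_trans (ler_normB _ _) (le_trans (lerD Xs Js) _).
by rewrite -mulrDl ler_wpM2r// /slot_cst lerDl.
Qed.

Definition value (w : 'rV[R]_k * 'rV[R]_N * 'cV[R]_M) : 'rV[R]_M :=
  F w.1.2 + w.1.2 *m Bmx w.1.1.

(** Entries of [B_c] in the disallowed positions vanish, so only allowed variables
    enter row [i] of the value. *)
Lemma value_close w w' tau i : critical w -> critical w' -> 0 <= tau -> i \in I ->
  (forall i j, i \in I -> j \in S i -> `|w.1.2 0 j - w'.1.2 0 j| <= tau) ->
  (forall l, `|w.1.1 0 l - w'.1.1 0 l| <= slot_cst * tau) ->
  `|value w 0 i - value w' 0 i| <= (K + N%:R * (K + K * slot_cst)) * tau.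
Proof.
move=> cw cw' tau0 iI Hx Hc; have K0 := K_ge0; have C1 := slot_cst_ge1.
have [_ wE _ _] := cw; have [_ wE' _ _] := cw'; have [_ Eb El] := tameE.
have [Fi _] := El w.1.2 w'.1.2 i tau wE wE' tau0 (fun j => Hx i j iI).
rewrite /value ![(_ + _ : 'rV__) 0 i]mxE opprD addrACA.
apply: le_trans (ler_normD _ _) _; rewrite [leRHS]mulrDl lerD//.
rewrite !mxE -sumrB -mulrA.
apply: (@le_trans _ _ (\sum_(j < N) (K + K * slot_cst) * tau)); last first.
  by rewrite sumr_const card_ord -[leLHS]mulr_natl.
apply: le_trans (ler_norm_sum _ _ _) (ler_sum _ _) => j _.
have [Sij|Sij] := boolP (j \in S i); last first.
  by rewrite !Bmx_out// !mulr0 subrr normr0 mulr_ge0// addr_ge0// mulr_ge0//; lra.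
have [l ul] := u_onto Sij.
have Bd : `|Bmx w.1.1 j i - Bmx w'.1.1 j i| <= slot_cst * tau.
  by have := Hc l; rewrite -!Bmx_slot ul.
set b := Bmx w.1.1 j i; set b' := Bmx w'.1.1 j i.
have -> : w.1.2 0 j * b - w'.1.2 0 j * b' =
    b * (w.1.2 0 j - w'.1.2 0 j) + w'.1.2 0 j * (b - b') by ring.
apply: le_trans (ler_normD _ _) _; rewrite mulrDl -mulrA !normrM.
have [xK _] := Eb _ wE'.
apply: lerD; apply: ler_pM => //; [exact: Bmx_le | exact: Hx Sij].
Qed.

(** The slot of a selected entry stores [x_j] and that of the value in equation
    [i] of [I] stores [l i]; since [l i0 = 1], coordinate [inr i0] is redundant. *)
Lemma null_critical_values :
  null [set c | ~ null [set value w | w in [set w |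
    (critical w /\ forall i, `|value w 0 i| <= K) /\ w.1.1 = c]]].
Proof.
have K0 := K_ge0; have C1 := slot_cst_ge1.
pose t (w : 'rV[R]_k * 'rV[R]_N * 'cV[R]_M) (s : 'I_k + 'I_M) : R := match s with
  | inl l => if selected l then w.1.2 0 (u l).2 else w.1.1 0 l
  | inr i => if i \in I then w.2 i 0 else value w 0 i
  end.
pose L : R := slot_cst + (K + N%:R * (K + K * slot_cst)).
have Q0 : 0 <= K + N%:R * (K + K * slot_cst).
  by rewrite addr_ge0// mulr_ge0// addr_ge0// mulr_ge0//; lra.
have L0 : 0 < L by rewrite /L; lra.
have K10 : 0 <= K + 1 by lra.
apply: (null_slices (c := fun w => w.1.1) (y := value) (t := t) (o := inr i0) K10 L0).
  move=> w [l|i] [cw vK] /=; have [cK wE _ _] := cw.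
    have [_ Eb _] := tameE; have [xK _] := Eb _ wE.
    by case: ifP => _; [have := xK (u l).2 | have := cK l]; lra.
  by case: ifP => _; [have := lambda_le i cw | have := vK i]; lra.
move=> w w' tau [cw _] [cw' _] tau0 tt.
have Hx i j : i \in I -> j \in S i -> `|w.1.2 0 j - w'.1.2 0 j| <= tau.
  move=> iI Sij; have [l sl ul] := selected_slot iI Sij.
  by have := tt (inl l) isT; rewrite /t sl ul.
have Hl i : `|w.2 i 0 - w'.2 i 0| <= tau.
  have [_ _ _ [l1 _ lO]] := cw; have [_ _ _ [l1' _ lO']] := cw'.
  have [->|ii0] := eqVneq i i0; first by rewrite l1 l1' subrr normr0.
  have [iI|iI] := boolP (i \in I); last by rewrite lO// lO'// subrr normr0.
  by have := tt (inr i) ii0; rewrite /t iI.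
have Hc l : ~~ selected l -> `|w.1.1 0 l - w'.1.1 0 l| <= tau.
  by move=> nsl; have := tt (inl l) isT; rewrite /t (negbTE nsl).
have cc := selected_close cw cw' tau0 Hx Hl Hc.
split=> [l|i].
  by apply: le_trans (cc l) _; rewrite ler_wpM2r// /L; lra.
have [iI|iI] := boolP (i \in I).
  apply: le_trans (value_close cw cw' tau0 iI Hx cc) _.
  by rewrite ler_wpM2r// /L; lra.
have ii0 : i != i0 by apply: contraNneq iI => ->.
have := tt (inr i) ii0; rewrite /t (negbTE iI) => /le_trans; apply.
by rewrite ler_peMl// /L; lra.
Qed.

(** The slots of the selected entries store the covector: [l i] goes to
    column [pi i].  The slot of column [pi i0] would store [l i0 = 1] and is redundant. *)
Lemma null_critical_points (pi : 'I_M -> 'I_N) :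
  injective pi -> (forall i, pi i \in S i) ->
  null [set c | ~ null [set w.1.2 | w in [set w | critical w /\ w.1.1 = c]]].
Proof.
move=> pi_inj piS; have K0 := K_ge0; have C1 := slot_cst_ge1.
have [l0 sl0 ul0] := selected_slot i0I (piS i0).
pose t (w : 'rV[R]_k * 'rV[R]_N * 'cV[R]_M) (s : 'I_k + 'I_N) : R := match s with
  | inl l => if selected l then
      (if [pick i in I | pi i == (u l).2] is Some i then w.2 i 0 else 0)
      else w.1.1 0 l
  | inr j => w.1.2 0 j
  end.
have L0 : 0 < slot_cst by lra.
have K10 : 0 <= K + 1 by lra.
apply: (null_slices (P := critical) (c := fun w => w.1.1) (y := fun w => w.1.2) (t := t)
  (o := inl l0) K10 L0).
  move=> w [l|j] cw /=; have [cK wE _ _] := cw.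
    case: ifP => _; last by have := cK l; lra.
    by case: pickP => [i _|_]; [have := lambda_le i cw; lra | rewrite normr0].
  by have [_ Eb _] := tameE; have [xK _] := Eb _ wE; have := xK j; lra.
move=> w w' tau cw cw' tau0 tt.
have Hx j : `|w.1.2 0 j - w'.1.2 0 j| <= tau by exact: tt (inr j) isT.
have Hl i : `|w.2 i 0 - w'.2 i 0| <= tau.
  have [_ _ _ [l1 _ lO]] := cw; have [_ _ _ [l1' _ lO']] := cw'.
  have [->|ii0] := eqVneq i i0; first by rewrite l1 l1' subrr normr0.
  have [iI|iI] := boolP (i \in I); last by rewrite lO// lO'// subrr normr0.
  have [l sl ul] := selected_slot iI (piS i).
  have ll0 : inl l != inl l0 :> 'I_k + 'I_N.
    apply: contraNneq ii0 => -[ll0]; apply/eqP/pi_inj.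
    by have := ul; rewrite ll0 ul0 => -[].
  have := tt _ ll0; rewrite /t sl ul /=; case: pickP => [i' /andP[_ /eqP /pi_inj ->]//|].
  by move=> /(_ i); rewrite iI eqxx.
have Hc l : ~~ selected l -> `|w.1.1 0 l - w'.1.1 0 l| <= tau.
  move=> nsl; have ll0 : inl l != inl l0 :> 'I_k + 'I_N.
    by apply: contraNneq nsl => -[->].
  by have := tt _ ll0; rewrite /t (negbTE nsl).
split=> [l|j]; first exact: (selected_close cw cw' tau0 (fun _ j _ _ => Hx j) Hl Hc).
by apply: le_trans (Hx j) _; rewrite ler_peMl.
Qed.
End Param.

(** * Almost every perturbation has few critical points and values *)


(** Points where the rank of [J] is below [M]; a kernel vector is what
    [critical] needs. *)
Definition crit_set (R : realType) (N M : nat) (U : set 'rV[R]_N) (J : 'rV[R]_N -> 'M[R]_(N, M)) :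
    set 'rV[R]_N :=
  [set x | U x /\ exists2 l : 'cV[R]_M, l != 0 & J x *m l = 0].

Section Generic.
Context {R : realType} {N M k : nat}.
Variables (S : structure N M) (u : 'I_k -> 'I_M * 'I_N).
Hypothesis u_inj : injective u.
Hypothesis u_allowed : forall l, (u l).2 \in S (u l).1.
Hypothesis u_onto : forall i j, j \in S i -> exists l, u l = (i, j).
Variables (U : set 'rV[R]_N) (F : 'rV[R]_N -> 'rV[R]_M) (pi : 'I_M -> 'I_N).
Hypothesis oU : open U.
Hypothesis sF : smooth_on U F.
Hypothesis rF : respects S U F.
Hypothesis pi_inj : injective pi.
Hypothesis piS : forall i, pi i \in S i.

(** Dividing by the entry of largest modulus normalizes the covector; all the
    bounds required are then met by every large integer. *)
Lemma critical_normalize (c : 'rV[R]_k) x (l : 'cV[R]_M) (E : set 'rV[R]_N) (K : R) :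
  E x -> l != 0 -> (Jac F x + Bmx u c) *m l = 0 ->
  exists (I : {set 'I_M}) (i0 : 'I_M) (l' : 'cV[R]_M) (m : nat), [/\ i0 \in I, K <= m%:R,
    forall n, (m <= n)%N -> critical u F I i0 n.+1%:R^-1 n%:R E (c, x, l')
    & forall i, `|value u F (c, x, l') 0 i| <= m%:R].
Proof.
move=> Ex l0 cl.
have [a la] : exists a, l a 0 != 0.
  apply: contrapT => h; case/eqP: l0; apply/matrixP => i j; rewrite ord1 mxE.
  by apply: contrapT => li; apply: h; exists i; apply/eqP.
case: (@arg_maxP _ _ _ a predT (fun i => `|l i 0|) isT) => b _ bmaxT.
have bmax i : `|l i 0| <= `|l b 0| by exact: bmaxT.
have lb : 0 < `|l b 0| by apply: lt_le_trans (bmax a); rewrite normr_gt0.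
pose l' : 'cV[R]_M := (l b 0)^-1 *: l.
pose y := value u F (c, x, l').
pose K1 : R := `|K| + \sum_l0 `|c 0 l0| + \sum_i `|y 0 i| + \sum_i `|l' i 0|^-1.
have sum_le (T : finType) (f : T -> R) i : (forall i, 0 <= f i) -> f i <= \sum_i f i.
  by move=> f0; rewrite (bigD1 i)//= lerDl sumr_ge0.
have s1 : 0 <= \sum_l0 `|c 0 l0| by rewrite sumr_ge0.
have s2 : 0 <= \sum_i `|y 0 i| by rewrite sumr_ge0.
have s3 : 0 <= \sum_i `|l' i 0|^-1 by rewrite sumr_ge0// => i _; rewrite invr_ge0.
have s0 := normr_ge0 K.
have K1m : K1 <= (Num.trunc K1).+1%:R by apply/ltW/truncnS_gt.
exists [set i | l i 0 != 0]%SET, b, l', (Num.trunc K1).+1; split.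
- by rewrite finset.inE -normr_gt0.
- by apply: le_trans K1m; have := ler_norm K; rewrite /K1; lra.
- move=> n mn; have K1n : K1 <= n%:R by apply: le_trans K1m _; rewrite ler_nat.
  split => //=.
  + move=> i; apply: le_trans K1n.
    by have := sum_le _ (fun l0 => `|c 0 l0|) i (fun=> normr_ge0 _); rewrite /K1; lra.
  + by rewrite -scalemxAr cl scaler0.
  + split.
    * by rewrite mxE mulVf// -normr_gt0.
    * move=> i; rewrite finset.inE => li; apply/andP; split; last first.
        by rewrite mxE normrM normfV mulrC ler_pdivrMr// mul1r bmax.
      have l'i : 0 < `|l' i 0|.
        by rewrite normr_gt0 mxE mulf_neq0// invr_neq0// -normr_gt0.
      rewrite -[leRHS]invrK lef_pV2 ?posrE ?invr_gt0//.
      have h : `|l' i 0|^-1 <= \sum_i `|l' i 0|^-1.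
        by apply: (sum_le _ (fun i => `|l' i 0|^-1) i) => j; rewrite invr_ge0.
      by apply: (@le_trans _ _ n%:R); [apply: le_trans K1n; rewrite /K1; lra | rewrite ler_nat].
    * by move=> i; rewrite finset.inE negbK mxE => /eqP ->; rewrite mulr0.
- move=> i; apply: le_trans K1m; rewrite -/y.
  by have := sum_le _ (fun i => `|y 0 i|) i (fun=> normr_ge0 _); rewrite /K1; lra.
Qed.

(** Witnesses are distributed over countably many pieces: tame rational cubes,
    supports [I] with their index [i0], and integers bounding all the data. *)
Lemma ae_critical_null :
  null [set c : 'rV[R]_k |
    ~ (null (crit_set U (fun x => Jac F x + Bmx u c)) /\
       null ((fun x => F x + x *m Bmx u c) @` crit_set U (fun x => Jac F x + Bmx u c)))].
Proof.
have [|||E [Etame UE]] := @rational_cubes R N U (fun A => exists K, tame S U F K A).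
- by exists 0; split.
- by move=> A B AB [K tK]; exists K; exact: tame_sub tK.
- by move=> x Ux; exact: tame_local.
pose T : countType := (('rV[rat]_N * rat) * ({set 'I_M} * 'I_M) * nat)%type.
pose good (t : T) := t.1.2.2 \in t.1.2.1 /\ tame S U F t.2%:R (E t.1.1).
pose crt (t : T) := critical u F t.1.2.1 t.1.2.2 t.2.+1%:R^-1 t.2%:R (E t.1.1).
pose vals (t : T) c := [set value u F w | w in [set w |
    (crt t w /\ forall i, `|value u F w 0 i| <= t.2%:R) /\ w.1.1 = c]].
pose pts (t : T) c := [set w.1.2 | w in [set w | crt t w /\ w.1.1 = c]].
pose bad t := [set c | good t /\ (~ null (vals t c) \/ ~ null (pts t c))].
have nbad : null (\bigcup_t bad t).
  apply: null_bigcup => t.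
  have [gt|ngt] := pselect (good t); last first.
    by apply: null_sub null_set0 => c [].
  have [i0I tE] := gt.
  have d0 : 0 < t.2.+1%:R^-1 :> R by rewrite invr_gt0.
  have nv := null_critical_values u_inj u_allowed u_onto i0I d0 (ler0n R t.2) tE.
  have np := null_critical_points u_inj u_allowed u_onto i0I d0 (ler0n R t.2) tE pi_inj piS.
  have nvp := null_union nv np.
  by apply: null_sub nvp => c [_ [?|?]]; [left|right].
apply: null_sub nbad => c /= nn; apply: contrapT => nb; apply: nn.
have ok t : good t -> null (vals t c) /\ null (pts t c).
  by move=> gt; split; apply: contrapT => h; apply: nb; exists t => //; split => //; [left|right].
have cover x : crit_set U (fun x => Jac F x + Bmx u c) x ->
    exists t, [/\ good t, vals t c (F x + x *m Bmx u c) & pts t c x].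
  move=> [Ux [l l0 cl]]; have [t _ Et] := UE _ Ux; have [K tK] := Etame t.
  have [I [i0 [l' [m [i0I Km cr vl]]]]] := critical_normalize K Et l0 cl.
  have cm := cr m (leqnn m).
  exists (t, (I, i0), m); split; first by split => //; exact: tame_le tK.
    by exists (c, x, l').
  by exists (c, x, l').
split.
  apply: (@null_sub _ _ _ (\bigcup_t (if `[< good t >] then pts t c else set0))).
    by move=> x /cover [t [gt _ pt]]; exists t => //; case: asboolP.
  by apply: null_bigcup => t; case: asboolP => [/ok[]//|_]; exact: null_set0.
apply: (@null_sub _ _ _ (\bigcup_t (if `[< good t >] then vals t c else set0))).
  by move=> _ [x /cover [t [gt vt _]] <-]; exists t => //; case: asboolP.
by apply: null_bigcup => t; case: asboolP => [/ok[]//|_]; exact: null_set0.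
Qed.
End Generic.

(** * Preimages of null sets under submersions *)


(** Quantitative inverse function theorem without inverse functions.  The array
    [H] perturbs [J0]; its entries are partial derivatives at different points.  The
    coordinates of [h] in the image of [f] are recovered from the others by inverting
    the minor of [J0]; [eta] is chosen so that the error is at most half of [`|h|]. *)
Lemma regular_coLipschitz (R : realType) (N M : nat) (J0 : 'M[R]_(N, M)) (f : 'I_M -> 'I_N) :
  rowsub f J0 \in unitmx -> injective f ->
  exists eta L : R, [/\ 0 < eta, 0 < L &
    forall (H : 'I_M -> 'I_N -> R) (h : 'rV[R]_N) tau, 0 <= tau ->
      (forall i j, `|H i j - J0 j i| <= eta) ->
      (forall i, `|\sum_j h 0 j * H i j| <= tau) ->
      (forall j, j \notin (f @: [set: 'I_M])%SET -> `|h 0 j| <= tau) ->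
      forall j, `|h 0 j| <= L * tau].
Proof.
move=> Ju f_inj.
pose X := invmx (rowsub f J0).
pose K : R := 1 + (\sum_i \sum_j `|X i j|) + \sum_i \sum_j `|J0 i j|.
have s1 : 0 <= \sum_i \sum_j `|X i j| by rewrite sumr_ge0// => i _; rewrite sumr_ge0.
have s2 : 0 <= \sum_i \sum_j `|J0 i j| by rewrite sumr_ge0// => i _; rewrite sumr_ge0.
have entry_le (a b : nat) (A : 'M[R]_(a, b)) i j : `|A i j| <= \sum_i \sum_j `|A i j|.
  rewrite (bigD1 i)//= (bigD1 j)//= -addrA lerDl addr_ge0 ?sumr_ge0// => i' _.
  by rewrite sumr_ge0.
have XK i j : `|X i j| <= K by have := entry_le _ _ X i j; rewrite /K; lra.
have JK i j : `|J0 i j| <= K by have := entry_le _ _ J0 i j; rewrite /K; lra.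
have K1 : 1 <= K by rewrite /K; lra.
pose Q : R := M%:R * K * N%:R.
have MK0 : 0 <= M%:R * K by rewrite mulr_ge0//; lra.
have NK0 : 0 <= N%:R * K by rewrite mulr_ge0//; lra.
have Q0 : 0 <= Q by rewrite mulr_ge0.
have MNK0 : 0 <= M%:R * K * (N%:R * K) by rewrite mulr_ge0.
pose eta : R := (2 * Q + 1)^-1.
have eta0 : 0 < eta by rewrite invr_gt0; lra.
(* This is what lets the error term be absorbed. *)
have Qeta : Q * eta <= 2^-1 by rewrite ler_pdivrMr; lra.
exists eta, (2 * (M%:R * K * (1 + N%:R * K) + 1)); split => //; first by lra.
move=> H h tau tau0 HJ Hh ho.
have m0 := normr_ge0 h.
pose rho : 'rV[R]_M := \row_i (\sum_j h 0 j * H i j - \sum_j h 0 j * (H i j - J0 j i)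
   - \sum_(j | j \notin (f @: [set: 'I_M])%SET) h 0 j * J0 j i).
have rhoE : (\row_i h 0 (f i)) *m rowsub f J0 = rho.
  apply/rowP => i; rewrite !mxE -sumrB.
  under [X in _ = X - _]eq_bigr do rewrite mulrBr opprB addrCA subrr addr0.
  rewrite (bigID (fun j => j \in (f @: [set: 'I_M])%SET)) /= addrK.
  rewrite big_imset /=; last by move=> a b _ _; exact: f_inj.
  rewrite [RHS](eq_bigl predT); last by move=> a; rewrite finset.inE.
  by apply: eq_bigr => a _; rewrite !mxE.
have rhole i : `|rho 0 i| <= tau + N%:R * (`|h| * eta) + N%:R * (K * tau).
  rewrite mxE; apply: le_trans (ler_normB _ _) (lerD _ _).
    apply: le_trans (ler_normB _ _) (lerD (Hh i) _).
    apply: (@le_trans _ _ (\sum_(j < N) `|h| * eta)).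
      apply: le_trans (ler_norm_sum _ _ _) (ler_sum _ _) => j _.
      by rewrite normrM ler_pM//; exact: coord_le_norm.
    by rewrite sumr_const card_ord -[leLHS]mulr_natl.
  apply: (@le_trans _ _ (\sum_(j < N) K * tau)).
    rewrite (le_trans (ler_norm_sum _ _ _))//.
    rewrite [leRHS](bigID (fun j => j \notin (f @: [set: 'I_M])%SET)) /= ler_wpDr//.
      by rewrite sumr_ge0// => j _; rewrite mulr_ge0//; lra.
    by apply: ler_sum => j jo; rewrite normrM mulrC ler_pM// ho.
  by rewrite sumr_const card_ord -[leLHS]mulr_natl.
have hfle i : `|h 0 (f i)| <= M%:R * (K * (tau + N%:R * (`|h| * eta) + N%:R * (K * tau))).
  have -> : h 0 (f i) = (rho *m X) 0 i.
    by rewrite -rhoE mulmxK// mxE.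
  rewrite mxE; apply: (@le_trans _ _ (\sum_(a < M) K * (tau + N%:R * (`|h| * eta) + N%:R * (K * tau)))).
    apply: le_trans (ler_norm_sum _ _ _) (ler_sum _ _) => a _.
    by rewrite normrM mulrC ler_pM.
  by rewrite sumr_const card_ord -[leLHS]mulr_natl.
have MKt : 0 <= M%:R * K * tau by rewrite mulr_ge0.
have MNKt : 0 <= M%:R * K * (N%:R * K) * tau by rewrite mulr_ge0.
have hQ : `|h| * (Q * eta) <= `|h| * 2^-1 by rewrite ler_wpM2l.
have hle : `|h| <= M%:R * K * (1 + N%:R * K) * tau + tau + `|h| * 2^-1.
  have b0 : 0 <= `|h| * 2^-1 by rewrite mulr_ge0.
  apply: norm_le_coord.
    by rewrite !addr_ge0// mulr_ge0// mulr_ge0//; lra.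
  move=> j; have [/finset.imsetP[i _ ->]|/ho jo] := boolP (j \in (f @: [set: 'I_M])%SET).
    apply: le_trans (hfle i) _.
    have -> : M%:R * (K * (tau + N%:R * (`|h| * eta) + N%:R * (K * tau))) =
        M%:R * K * (1 + N%:R * K) * tau + `|h| * (Q * eta) by rewrite /Q; ring.
    by lra.
  by apply: le_trans jo _; rewrite mulrDr mulr1 mulrDl; lra.
move=> j; apply: le_trans (coord_le_norm h j) _.
rewrite -mulrA mulrDl mul1r; lra.
Qed.

(** Near a point of full rank, the values of [G] together with the coordinates
    outside an invertible minor determine the point with Lipschitz dependence. *)
Lemma null_regular_preimage (R : realType) (N M : nat) (U : set 'rV[R]_N)
    (G : 'rV[R]_N -> 'rV[R]_M) (C : set 'rV[R]_M) :
  open U -> smooth_on U G -> (0 < M)%N -> null C ->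
  null [set p | U p /\ row_full (Jac G p) /\ C (G p)].
Proof.
move=> oU sG M0 nC; apply: locally_null => p0 [Up0 [Jfull _]].
pose f := fullrankfun Jfull.
have f_inj : injective f by exact: fullrankfun_inj.
have [eta [L [eta0 L0 HL]]] := regular_coLipschitz (fullrowsub_unit Jfull) f_inj.
have hU : nbhs p0 U by apply: open_nbhs_nbhs.
have hJ : \forall y \near p0, forall j i, `|Jac G y j i - Jac G p0 j i| <= eta.
  apply: (@filter_forall _ _ _ (nbhs p0) _) => j.
  apply: (@filter_forall _ _ _ (nbhs p0) _) => i.
  exact: (near_norm (@smooth_Jac_continuous _ _ _ U G p0 j i sG Up0) eta0).
have [r r0 rP] := nbhs_cube (filterI hU hJ).
exists r => //.
pose T : finType := {j | j \notin (f @: [set: 'I_M])%SET}.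
have cardT : (#|T| + M)%N = N.
  rewrite card_sig -[X in (_ + X)%N](card_ord M) -[X in (_ + X)%N]cardsT.
  rewrite -(card_imset _ f_inj) -[RHS](card_ord N) -(cardC (mem (f @: [set: 'I_M])%SET)) addnC.
  by congr (_ + _)%N; apply: eq_card.
have B0 : 0 <= `|p0| + r by rewrite addr_ge0// ltW.
apply: (null_preimage (pr := (val : T -> 'I_N)) (g := G) cardT M0 B0 L0 nC).
- by move=> p [[_ [_ Cp]] _].
- move=> p s [_ /(_ (val s)) ps]; have := coord_le_norm p0 (val s).
  by have := ler_normD (p 0 (val s) - p0 0 (val s)) (p0 0 (val s)); rewrite subrK; lra.
- move=> p p' tau [_ pr] [_ pr'] tau0 Gp pp j.
  have /choice [xi xiP] (i : 'I_M) : exists xi : 'I_N -> 'rV[R]_N,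
      (forall j, cube p0 r (xi j)) /\
      G p 0 i - G p' 0 i = \sum_j (p 0 j - p' 0 j) * Jac G (xi j) j i.
    have d y k : cube p0 r y -> derivable (fun y => G y 0 i) y (delta_mx 0 k).
      by move=> /rP [Uy _]; have [] := smooth_coord k i sG Uy.
    have [xi xiC e] := mvt_coords d pr' pr; exists xi; split => //.
    rewrite e; apply: eq_bigr => k _; congr (_ * _).
    by have [Uk _] := rP _ (xiC k); have [] := smooth_coord k i sG Uk.
  have := HL (fun i j => Jac G (xi i j) j i) (p - p') tau tau0 _ _ _ j.
  rewrite !mxE; apply.
  + by move=> i k; have [xiC _] := xiP i; have [_] := rP _ (xiC k); apply.
  + move=> i; have [_ e] := xiP i; have := Gp i; rewrite e.
    have -> // : \sum_k (p - p') 0 k * Jac G (xi i k) k i =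
        \sum_k (p 0 k - p' 0 k) * Jac G (xi i k) k i.
    by apply: eq_bigr => k _; congr (_ * _); rewrite !mxE.
  + by move=> k ko; have := pp (Sub k ko); rewrite /= !mxE.
Qed.

(** * The conclusion *)


(** Some term of the Leibniz expansion of a nonzero [M]-minor is nonzero, and its
    factors sit in allowed positions. *)
Lemma max_rank_matching (R : realType) (N M : nat) (S : structure N M) :
  max_rank R S = M ->
  exists2 pi : 'I_M -> 'I_N, injective pi & forall i, pi i \in S i.
Proof.
move=> rM; have [[A SA rA] _] := max_rankP R S.
have Afull : row_full A^T by rewrite /row_full mxrank_tr rA rM.
have := fullrowsub_unit Afull; set f := fullrankfun Afull.
rewrite unitmxE unitfE => det0.
have [s sP] : exists s : {perm 'I_M}, forall i, A (s i) (f i) != 0.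
  apply: contrapT => nos; case/eqP: det0; rewrite /determinant big1// => s _.
  have [i Ai] : exists i, A (s i) (f i) = 0.
    apply: contrapT => h; apply: nos; exists s => i; apply/eqP => Ai.
    by apply: h; exists i.
  by rewrite (bigD1 i)//= !mxE Ai mul0r mulr0.
exists (fun i => f ((s^-1)%g i)).
  by move=> i i' /(@fullrankfun_inj _ _ _ _ Afull) /perm_inj.
move=> i; apply: contraNT (sP ((s^-1)%g i)) => Si.
by rewrite permKV SA.
Qed.

Lemma row_full_or_kernel (R : fieldType) (N M : nat) (J : 'M[R]_(N, M)) :
  ~~ row_full J -> exists2 l : 'cV[R]_M, l != 0 & J *m l = 0.
Proof.
move=> nfull; have : kermx J^T != 0 by rewrite kermx_eq0 /row_free mxrank_tr.
case/rowV0Pn => v /sub_kermxP vJ v0; exists v^T; first by rewrite trmx_eq0.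
by rewrite -[LHS]trmxK trmx_mul trmxK vJ trmx0.
Qed.

Lemma derive_mulmx (R : realType) (N M : nat) (B : 'M[R]_(N, M)) (x v : 'rV[R]_N) :
  is_derive x v (fun y : 'rV[R]_N => y *m B) (v *m B).
Proof.
have E : \forall h \near (0 : R)^', h^-1 *: ((h *: v + x) *m B - x *m B) = v *m B.
  near=> h; have h0 : h != 0 by near: h; exact: nbhs_dnbhs_neq.
  by rewrite mulmxDl addrK -scalemxAl scalerA mulVf// scale1r.
by apply: DeriveDef; [exact: is_cvg_near_cst E | exact: lim_near_cst E].
Unshelve. all: by end_near. Qed.

Lemma Jac_add_linear (R : realType) (N M : nat) (U : set 'rV[R]_N)
    (F G : 'rV[R]_N -> 'rV[R]_M) (B : 'M[R]_(N, M)) x :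
  open U -> smooth_on U F -> (forall y, U y -> G y = F y + y *m B) -> U x ->
  Jac G x = Jac F x + B.
Proof.
move=> oU sF GF Ux; apply/matrixP => j i; rewrite !mxE.
have -> : partial j G x = partial j F x + delta_mx 0 j *m B.
  have [_ /(_ j) dF] := sF [::] x Ux.
  have dB := derive_mulmx B x (delta_mx 0 j).
  rewrite /partial (@near_eq_derive _ _ _ G (F + (fun y => y *m B))).
    rewrite deriveD; [|exact: dF|by case: dB].
    by congr (_ + _); exact: (@derive_val _ _ _ _ _ _ _ dB).
  have : nbhs x U by apply: open_nbhs_nbhs.
  by apply: filterS => y /GF ->.
by rewrite mxE -rowE mxE.
Qed.

(** A linear map that vanishes on a nonempty open set is zero. *)
Lemma independent_Bmx (R : realType) (N M k : nat) (S : structure N M)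
    (u : 'I_k -> 'I_M * 'I_N) (U : set 'rV[R]_N) (x0 : 'rV[R]_N) (c : 'rV[R]_k) :
  injective u -> open U -> U x0 -> (forall x, U x -> x *m Bmx u c = 0) -> c = 0.
Proof.
move=> u_inj oU Ux0 cU.
have [r r0 rU] : exists2 r : R, 0 < r & cube x0 r `<=` U.
  by apply: nbhs_cube; exact: open_nbhs_nbhs.
have B0 j : (delta_mx 0 j : 'rV[R]_N) *m Bmx u c = 0.
  have Ux : U (x0 + r *: delta_mx 0 j).
    apply: rU => i; rewrite !mxE addrAC subrr add0r normrM gtr0_norm//=.
    by case: (i == j); rewrite /= ?normr1 ?normr0 ?mulr1 ?mulr0// ltW.
  have := cU _ Ux; rewrite mulmxDl cU// add0r -scalemxAl => /eqP.
  by rewrite scaler_eq0 gt_eqF//= => /eqP.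
apply/rowP => l; rewrite -(Bmx_slot u_inj) [RHS]mxE.
by have /rowP /(_ (u l).1) := B0 (u l).2; rewrite -rowE !mxE.
Qed.

Lemma nonrobust_cover (R : realType) (N M : nat) (U : set 'rV[R]_N) (G : 'rV[R]_N -> 'rV[R]_M) p :
  open U -> smooth_on U G -> U p -> ~ robust_SolSet U G p ->
  crit_set U (Jac G) p \/ (row_full (Jac G p) /\ (G @` crit_set U (Jac G)) (G p)).
Proof.
move=> oU sG Up nr.
have [x [Ux Gx] nrx] : exists2 x, SolSet U G p x & ~ robust_point G x.
  apply: contrapT => h; apply: nr => x xp; apply: contrapT => nx.
  by apply: h; exists x.
have xcrit : crit_set U (Jac G) x.
  split=> //; apply: row_full_or_kernel; apply/negP => /eqP full; apply: nrx.
  by rewrite /robust_point /DF mxrank_tr (smooth_differentiable oU sG Ux).2.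
have [pfull|nfull] := boolP (row_full (Jac G p)).
  right; split; first by [].
  by exists x; [exact: xcrit | exact: Gx].
left; split; first exact: Up.
exact: row_full_or_kernel nfull.
Qed.

Theorem proposition1 (R : realType) (N M : nat) (U : set 'rV[R]_N)
    (S : structure N M) (Fs : set ('rV[R]_N -> 'rV[R]_M)) :
  open U ->
  function_space S U Fs ->
  max_rank R S = M ->
  prevalent U Fs (fun F => almost_every U (fun p => robust_SolSet U F p)).
Proof.
move=> oU [[Fs0 Fslin] Fsreg Fsmx] rM.
(* If [M = 0] or [U] is empty every function has the property, so the probing
   subspace may be zero; over the empty set it has to be, no nonempty family
   being independent there. *)
have [triv|nontriv] := pselect (M = 0%N \/ U = set0).
  exists 0%N, (fun i => 0); split; first by case.
  - by move=> c _; apply/rowP => -[].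
  - move=> F _; apply: null_lebesgue_null; apply: null_sub null_set0 => c [_]; apply.
    apply: null_lebesgue_null; apply: null_sub null_set0 => p [Up]; apply.
    case: triv => [M0|U0]; last by move: Up; rewrite U0.
    move=> x _; apply/eqP; rewrite eqn_leq rank_leq_row /=.
    by apply: leq_trans (leq0n _); rewrite leqn0 M0.
have M0 : (0 < M)%N by rewrite lt0n; apply/eqP => h; apply: nontriv; left.
have [x0 Ux0] : U !=set0 by apply/set0P/eqP => h; apply: nontriv; right.
have [pi pi_inj piS] := max_rank_matching rM.
(* The probing subspace consists of the structured linear maps; its basis is
   indexed by the allowed entries. *)
pose P := [set p : 'I_M * 'I_N | p.2 \in S p.1]%SET.
pose u (l : 'I_#|P|) := enum_val l.
have u_inj : injective u by exact: enum_val_inj.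
have u_allowed l : (u l).2 \in S (u l).1 by have := enum_valP l; rewrite finset.inE.
have u_onto i j : j \in S i -> exists l, u l = (i, j).
  move=> Sij; have ijP : (i, j) \in P by rewrite finset.inE.
  by exists (enum_rank_in ijP (i, j)); rewrite /u enum_rankK_in.
have /choice [q qP] (l : 'I_#|P|) : exists q : 'rV[R]_N -> 'rV[R]_M,
    Fs q /\ forall x, U x -> q x = x *m delta_mx (u l).2 (u l).1.
  have [|q Fq qx] := Fsmx (delta_mx (u l).1 (u l).2).
    move=> i j; rewrite mxE; have := u_allowed l.
    case: eqP => [->|]; case: eqP => [->|]//=; first by move=> ->.
  by exists q; split => // x /qx ->; rewrite trmx_delta.
have qsum (c : 'rV[R]_#|P|) x : U x -> \sum_l c 0 l *: q l x = x *m Bmx u c.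
  move=> Ux; rewrite /Bmx mulmx_sumr; apply: eq_bigr => l _.
  by rewrite (qP l).2// scalemxAr.
exists #|P|, q; split.
- by move=> l; have [] := qP l.
- move=> c qc; apply: (independent_Bmx S u_inj oU Ux0) => x Ux.
  by rewrite -qsum// qc.
move=> F FF; have [sF rF] := Fsreg F FF.
apply: null_lebesgue_null.
apply: null_sub (ae_critical_null u_inj u_allowed u_onto oU sF rF pi_inj piS).
move=> c /= [_ nQ] [nP nV]; apply: nQ.
set G := F + _.
have GF x : U x -> G x = F x + x *m Bmx u c.
  move=> Ux; rewrite /G fctE fct_sumE -qsum//.
have memE g : (g \in mem Fs) = (g \in Fs) by [].
have FG : Fs G.
  have mem_sum : \sum_i c 0 i *: q i \in mem Fs.
    elim/big_rec: _ => [//|i g _ gF]; apply: Fslin => //.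
    by rewrite memE in_setE; have [] := qP i.
  by have := Fslin 1 F _ _ mem_sum; rewrite scale1r !memE !in_setE; apply.
have [sG _] := Fsreg G FG.
have JG x : U x -> Jac G x = Jac F x + Bmx u c by exact: Jac_add_linear.
have critE : crit_set U (Jac G) = crit_set U (fun x => Jac F x + Bmx u c).
  by apply/seteqP; split=> x [Ux]; [rewrite JG//|rewrite -JG//]; split.
apply: null_lebesgue_null.
pose C := (fun x => F x + x *m Bmx u c) @` crit_set U (Jac G).
have nC : null C by rewrite /C critE.
have nP' : null (crit_set U (Jac G)) by rewrite critE.
apply: null_sub (null_union nP' (null_regular_preimage oU sG M0 nC)).
move=> p [Up nr]; have [pc|[pf [x xc xp]]] := nonrobust_cover oU sG Up nr; first by left.
by right; split=> //; split=> //; exists x => //; rewrite -GF//; case: xc.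
Qed.
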